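(* Let $n\geqslant 4$ and let $M_n$ be the set of all strictly convex closed polyhedra in $\mathbb{R}^3$ with $n$ faces, endowed with the Hausdorff metric. There exists an open dense subset $\Omega_n\subset M_n$ such that for any $P,P'\in\Omega_n$ the following conditions are equivalent: (i) $P$ and $P'$ are combinatorially equivalent and every two corresponding faces are affine-equivalent; (ii) $P$ and $P'$ are affine-equivalent.
   Context: A closed convex polyhedron is strictly convex if none of its dihedral angles equals $\pi$. Two polyhedra are combinatorially equivalent if there is an incidence-preserving bijection between their vertices, edges and faces. Two corresponding polygons (resp. combinatorially equivalent polyhedra) are affine-equivalent if there is a nondegenerate affine map of the plane/space carrying the first onto the second and each vertex, edge (and face) to the corresponding one. *)

(* Defs.v *)
From HB Require Import structures.
From mathcomp Require Import all_boot all_order all_algebra.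
From mathcomp Require Import boolp classical_sets reals.
Set Implicit Arguments. Unset Strict Implicit. Unset Printing Implicit Defensive.
Import Order.TTheory GRing.Theory Num.Theory.
Local Open Scope ring_scope.
Local Open Scope classical_set_scope.

Definition pt (R : realType) := 'rV[R]_3.

Definition dot (R : realType) (x y : pt R) : R := \sum_(i < 3) x 0 i * y 0 i.

Definition edist (R : realType) (x y : pt R) : R := Num.sqrt (dot (x - y) (x - y)).

Definition conv_hull (R : realType) (k : nat) (v : 'I_k -> pt R) : set (pt R) :=
  [set x | exists l : 'I_k -> R, (forall i, 0 <= l i) /\ \sum_(i < k) l i = 1 /\
                                  x = \sum_(i < k) l i *: v i].

Definition is_polyhedron (R : realType) (P : set (pt R)) : Prop :=
  (exists k (v : 'I_k -> pt R), P = conv_hull v) /\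
  (exists x e, 0 < e /\ forall y, edist x y < e -> P y).

Definition is_face (R : realType) (P F : set (pt R)) : Prop :=
  exists c : pt R, c != 0 /\
    F = [set x | P x /\ forall y, P y -> dot c y <= dot c x].

Definition collinear (R : realType) (F : set (pt R)) : Prop :=
  exists p d : pt R, forall x, F x -> exists t : R, x = p + t *: d.

Definition is_vertex (R : realType) (P F : set (pt R)) : Prop :=
  is_face P F /\ exists v, F = [set v].

Definition is_edge (R : realType) (P F : set (pt R)) : Prop :=
  is_face P F /\ collinear F /\ ~ (exists v, F = [set v]).

Definition is_facet (R : realType) (P F : set (pt R)) : Prop :=
  is_face P F /\ ~ collinear F.

Definition is_cell (R : realType) (P F : set (pt R)) : Prop :=
  is_vertex P F \/ is_edge P F \/ is_facet P F.

Definition has_n_facets (R : realType) (P : set (pt R)) (n : nat) : Prop :=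
  exists f : 'I_n -> set (pt R), injective f /\
    forall F, is_facet P F <-> exists i, F = f i.

Definition M_ (R : realType) (n : nat) : set (set (pt R)) :=
  [set P | is_polyhedron P /\ has_n_facets P n].

(* Hausdorff distance < e (between compact sets) *)
Definition hclose (R : realType) (e : R) (P Q : set (pt R)) : Prop :=
  (forall x, P x -> exists y, Q y /\ edist x y < e) /\
  (forall y, Q y -> exists x, P x /\ edist x y < e).

Definition hopen_in (R : realType) (M Om : set (set (pt R))) : Prop :=
  forall P, Om P -> exists e : R, 0 < e /\ forall Q, M Q -> hclose e P Q -> Om Q.

Definition hdense_in (R : realType) (M Om : set (set (pt R))) : Prop :=
  forall P, M P -> forall e : R, 0 < e -> exists Q, Om Q /\ hclose e P Q.

Definition comb_equiv (R : realType) (P P' : set (pt R))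
    (phi : set (pt R) -> set (pt R)) : Prop :=
  (forall F, is_vertex P F -> is_vertex P' (phi F)) /\
  (forall F, is_edge P F -> is_edge P' (phi F)) /\
  (forall F, is_facet P F -> is_facet P' (phi F)) /\
  (forall F G, is_cell P F -> is_cell P G -> phi F = phi G -> F = G) /\
  (forall F', is_cell P' F' -> exists F, is_cell P F /\ phi F = F') /\
  (forall F G, is_cell P F -> is_cell P G -> (F `<=` G <-> phi F `<=` phi G)).

Definition amap (R : realType) (A : 'M[R]_3) (b : pt R) (x : pt R) : pt R :=
  x *m A + b.

(* every two corresponding faces are affine-equivalent (the affine map of the
   plane is represented by a nondegenerate affine map of space) *)
Definition faces_affine_equiv (R : realType) (P P' : set (pt R))
    (phi : set (pt R) -> set (pt R)) : Prop :=
  forall F, is_facet P F -> exists (A : 'M[R]_3) (b : pt R),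
    A \in unitmx /\ amap A b @` F = phi F /\
    forall G, is_vertex P G \/ is_edge P G -> G `<=` F -> amap A b @` G = phi G.

Definition poly_affine_equiv (R : realType) (P P' : set (pt R))
    (phi : set (pt R) -> set (pt R)) : Prop :=
  exists (A : 'M[R]_3) (b : pt R),
    A \in unitmx /\ amap A b @` P = P' /\
    forall G, is_cell P G -> amap A b @` G = phi G.

(* Main.v *)
(** Call a polyhedron simple when no point of it lies on four facets; simple
    polyhedra form the required open dense set.  Density: write
    P = {x | a_i x <= b_i} and replace b_i by b_i + t^(i+1); four planes are
    concurrent only when t is a root of some nonzero polynomial.  Openness:
    the facet planes of a nearby polyhedron with the same number of facets
    are close to those of P, in a bijective way.  Rigidity: at a simple vertex
    the affine maps of the three incident facets, which agree on the common
    edges, glue to a single affine map of space; the maps of two adjacent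
    vertices agree on the two facets along their edge, hence coincide, and
    the edge graph is connected by the simplex method. *)
Require Import Defs.
From HB Require Import structures.
From mathcomp Require Import all_boot all_order all_algebra.
From mathcomp Require Import boolp classical_sets reals.
From mathcomp Require Import ring lra.
Set Implicit Arguments. Unset Strict Implicit. Unset Printing Implicit Defensive.
Import Order.TTheory GRing.Theory Num.Theory.
Local Open Scope ring_scope.
Local Open Scope classical_set_scope.

(** The working form of a polyhedron is a system of inequalities with exactly one index per facet
    ([hrep]), so polyhedra with equally many facets have systems over the same ['I_n]. Such a system
    comes from generators by Fourier-Motzkin elimination and a choice of minimal length. Simplicity
    matters because three independent facet normals have a dual basis of edge directions, on which a
    linear map can be prescribed freely; with more facets at a vertex the edge directions are
    dependent and the facet maps need not fit together. The obstacle to openness is that the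
    inequalities of a nearby polyhedron have arbitrary scale; slacks are therefore compared relative
    to their values at one fixed interior point of [P]. Uniform constants are extrema over finitely
    many indices or generators, since an affine function on a hull is controlled at the generators;
    this replaces compactness. *)

(** * Scalar product, norm and finite extrema *)

Section Dot.
Variable R : realType.
Implicit Types (x y d : pt R) (t : R).

Lemma dotE x y : dot x y = (x *m y^T) 0 0.
Proof. by rewrite mxE; apply: eq_bigr => i _; rewrite mxE. Qed.

Lemma dotC x y : dot x y = dot y x.
Proof. by apply: eq_bigr => i _; rewrite mulrC. Qed.

Lemma dotDr x y d : dot x (y + d) = dot x y + dot x d.
Proof. by rewrite /dot -big_split; apply: eq_bigr => i _; rewrite mxE mulrDr. Qed.

Lemma dotZr t x y : dot x (t *: y) = t * dot x y.
Proof. by rewrite /dot mulr_sumr; apply: eq_bigr => i _; rewrite mxE mulrCA. Qed.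

Lemma dotNr x y : dot x (- y) = - dot x y.
Proof. by rewrite -scaleN1r dotZr mulN1r. Qed.

Lemma dotBr x y d : dot x (y - d) = dot x y - dot x d.
Proof. by rewrite dotDr dotNr. Qed.

Lemma dot0r x : dot x 0 = 0.
Proof. by rewrite -(scale0r 0) dotZr mul0r. Qed.

Lemma dotDl x y d : dot (x + y) d = dot x d + dot y d.
Proof. by rewrite !(dotC _ d) dotDr. Qed.

Lemma dotZl t x y : dot (t *: x) y = t * dot x y.
Proof. by rewrite dotC dotZr dotC. Qed.

Lemma dotNl x y : dot (- x) y = - dot x y.
Proof. by rewrite dotC dotNr dotC. Qed.

Lemma dot0l x : dot 0 x = 0.
Proof. by rewrite dotC dot0r. Qed.

Lemma dot_sumr (I : Type) (s : seq I) (p : pred I) (F : I -> pt R) x :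
  dot x (\sum_(i <- s | p i) F i) = \sum_(i <- s | p i) dot x (F i).
Proof.
by elim/big_rec2: _ => [|i y1 y2 _ <-]; rewrite ?dot0r // dotDr.
Qed.

Lemma dot_suml (I : Type) (s : seq I) (p : pred I) (F : I -> pt R) x :
  dot (\sum_(i <- s | p i) F i) x = \sum_(i <- s | p i) dot (F i) x.
Proof. by rewrite dotC dot_sumr; apply: eq_bigr => i _; rewrite dotC. Qed.

Definition dotl := (dotDr, dotZr, dotNr, dotDl, dotZl, dotNl, dot0r, dot0l).

Lemma dot_ge0 x : 0 <= dot x x.
Proof. by apply: sumr_ge0 => i _; rewrite -expr2 sqr_ge0. Qed.

Lemma dot_eq0 x : (dot x x == 0) = (x == 0).
Proof.
apply/idP/eqP => [|->]; last by rewrite dot0r.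
rewrite psumr_eq0 => [/allP h|i _]; last by rewrite -expr2 sqr_ge0.
apply/rowP => i; rewrite mxE; apply/eqP.
by have := h i (mem_index_enum _); rewrite -expr2 sqrf_eq0.
Qed.

Lemma dot_gt0 x : (0 < dot x x) = (x != 0).
Proof. by rewrite lt_def dot_ge0 andbT dot_eq0. Qed.

Lemma dot_CS x y : dot x y ^+ 2 <= dot x x * dot y y.
Proof.
have [->|y0] := eqVneq y 0; first by rewrite !dot0r expr0n mulr0.
have yy : 0 < dot y y by rewrite dot_gt0.
have := dot_ge0 (dot y y *: x - dot x y *: y).
rewrite !dotl (dotC y x) => h.
have {}h : 0 <= dot y y * (dot x x * dot y y - dot x y ^+ 2).
  by apply: le_trans h _; rewrite le_eqVlt; apply/orP; left; apply/eqP; ring.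
by move: h; rewrite pmulr_rge0 // subr_ge0.
Qed.

Definition nrm x := Num.sqrt (dot x x).

Lemma nrm_ge0 x : 0 <= nrm x. Proof. exact: sqrtr_ge0. Qed.

Lemma nrm_gt0 x : (0 < nrm x) = (x != 0).
Proof. by rewrite sqrtr_gt0 dot_gt0. Qed.

Lemma sqr_nrm x : nrm x ^+ 2 = dot x x.
Proof. by rewrite sqr_sqrtr // dot_ge0. Qed.

Lemma edistE x y : edist x y = nrm (x - y). Proof. by []. Qed.

Lemma nrmN x : nrm (- x) = nrm x.
Proof. by rewrite /nrm !dotl opprK. Qed.

Lemma nrmZ t x : nrm (t *: x) = `|t| * nrm x.
Proof. by rewrite /nrm !dotl mulrA -expr2 sqrtrM ?sqr_ge0 // sqrtr_sqr. Qed.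

Lemma edistC x y : edist x y = edist y x.
Proof. by rewrite !edistE -nrmN opprB. Qed.

Lemma edistxx x : edist x x = 0.
Proof. by rewrite edistE subrr /nrm dot0r sqrtr0. Qed.

Lemma dot_norm_le x y : `|dot x y| <= nrm x * nrm y.
Proof.
rewrite -ler_sqr ?nnegrE ?mulr_ge0 ?nrm_ge0 //.
by rewrite exprMn !sqr_nrm real_normK ?num_real // dot_CS.
Qed.

Lemma dot_le x y : dot x y <= nrm x * nrm y.
Proof. exact: le_trans (ler_norm _) (dot_norm_le _ _). Qed.

Lemma edist_step r z u : 0 < r -> u != 0 -> edist z (z + (r / 2 / nrm u) *: u) < r.
Proof.
move=> r0 u0; have nu : 0 < nrm u by rewrite nrm_gt0.
rewrite edistE opprD addrA subrr add0r nrmN nrmZ gtr0_norm ?divr_gt0 //.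
by rewrite divfK ?gt_eqF //; lra.
Qed.

Lemma min_pos (n : nat) (f : 'I_n -> R) : (forall i, 0 < f i) ->
  exists e, 0 < e /\ forall i, e <= f i.
Proof.
elim: n f => [|n IH] f f0; first by exists 1; split=> // -[].
have [e [e0 he]] := IH (fun i => f (lift ord0 i)) (fun i => f0 _).
exists (Num.min e (f ord0)); split; first by rewrite lt_min e0 f0.
move=> i; rewrite ge_min; case: (unliftP ord0 i) => [j ->|->]; first by rewrite he.
by rewrite lexx orbT.
Qed.

Lemma min_pos_fin (I : finType) (f : I -> R) : (forall i, 0 < f i) ->
  exists e, 0 < e /\ forall i, e <= f i.
Proof.
move=> f0; have [e [e0 he]] := min_pos (fun i : 'I_#|I| => f0 (enum_val i)).
by exists e; split=> // i; rewrite -(enum_rankK i).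
Qed.

Lemma max_fin (I : finType) (f : I -> R) : exists e, 0 < e /\ forall i, f i <= e.
Proof.
exists (1 + \sum_i `|f i|); split; first by apply: ltr_pwDl => //; apply: sumr_ge0.
move=> i; rewrite (bigD1 i) //=.
have := ler_norm (f i); have : 0 <= \sum_(j | j != i) `|f j| by by apply: sumr_ge0.
lra.
Qed.

End Dot.

(** * Convex hulls of finitely many points *)

Section Hull.
Variables (R : realType) (k : nat) (v : 'I_k -> pt R).

Definition convex_pred (Phi : pt R -> Prop) := forall x y s t,
  0 <= s -> 0 <= t -> s + t = 1 -> Phi x -> Phi y -> Phi (s *: x + t *: y).

Lemma conv_hull_convex : convex_pred (conv_hull v).
Proof.
move=> x y s t s0 t0 st [l [l0 [l1 ->]]] [m [m0 [m1 ->]]].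
exists (fun i => s * l i + t * m i); split.
  by move=> i; rewrite addr_ge0 ?mulr_ge0.
split; first by rewrite big_split /= -!mulr_sumr l1 m1 !mulr1.
by rewrite !scaler_sumr -big_split; apply: eq_bigr => i _; rewrite scalerDl !scalerA.
Qed.

Lemma conv_hull_gen i : conv_hull v (v i).
Proof.
exists (fun j => (j == i)%:R); split; first by move=> j; rewrite ler0n.
split; first by rewrite (bigD1 i) //= eqxx big1 ?addr0 // => j /negPf ->.
rewrite (bigD1 i) //= eqxx scale1r big1 ?addr0 // => j /negPf ->.
by rewrite scale0r.
Qed.

Lemma conv_hull_le (c : pt R) m x : (forall i, dot c (v i) <= m) ->
  conv_hull v x -> dot c x <= m.
Proof.
move=> h [l [l0 [l1 ->]]]; rewrite dot_sumr -[m]mul1r -l1 mulr_suml.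
by apply: ler_sum => i _; rewrite dotZr ler_wpM2l.
Qed.

End Hull.

(** * Half-space representations *)

Section Hrep.
Variables (R : realType) (n : nat) (a : 'I_n -> pt R) (b : 'I_n -> R).
Implicit Types (x y z d w : pt R) (t : R) (P : set (pt R)).

(** [hrep_irr] supplies a relative interior point of each facet, so no index is redundant or
    repeated; [hrep_rec], a trivial recession cone, is boundedness in algebraic form. *)
Record hrep P : Prop := Hrep {
  hrepE : forall x, P x <-> forall i, dot (a i) x <= b i;
  hrep_int : exists z, forall i, dot (a i) z < b i;
  hrep_irr : forall i, exists y,
    dot (a i) y = b i /\ forall j, j != i -> dot (a j) y < b j;
  hrep_rec : forall d, (forall i, dot (a i) d <= 0) -> d = 0 }.

Definition tight x : {set 'I_n} := [set i | dot (a i) x == b i].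

Lemma tightP x i : reflect (dot (a i) x = b i) (i \in tight x).
Proof. by rewrite inE; apply: eqP. Qed.

(** Says that the tight normals span the space, the linear-algebra form of being a vertex. *)
Definition extreme x := forall d, (forall i, i \in tight x -> dot (a i) d = 0) -> d = 0.

Lemma extreme_inj x y : extreme x -> tight x = tight y -> x = y.
Proof.
move=> ex txy; apply/eqP; rewrite -subr_eq0; apply/eqP; apply: ex => i ti.
by rewrite dotBr (tightP _ _ ti); move: ti; rewrite txy => /tightP ->; rewrite subrr.
Qed.

Variables (P : set (pt R)) (hP : hrep P).

Lemma hrep_le x i : P x -> dot (a i) x <= b i.
Proof. by move/(hrepE hP). Qed.

Lemma hrep_lt x i : P x -> i \notin tight x -> dot (a i) x < b i.
Proof. by move=> Px; rewrite inE lt_neqAle => -> /=; apply: hrep_le. Qed.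

Lemma hrep_convex : convex_pred P.
Proof.
move=> x y s t s0 t0 st Px Py; apply/(hrepE hP) => i; rewrite !dotl.
have := ler_wpM2l s0 (hrep_le i Px); have := ler_wpM2l t0 (hrep_le i Py).
have : b i = s * b i + t * b i by rewrite -mulrDl st mul1r.
lra.
Qed.

(** The ratio test of the simplex method: [t] is the least quotient of slack by slope among the
    constraints that [d] approaches. *)
Lemma ray x d : P x -> d != 0 -> exists t i, [/\ 0 <= t, P (x + t *: d),
  0 < dot (a i) d, dot (a i) x + t * dot (a i) d = b i &
  (forall j, j \in tight x -> dot (a j) d <= 0) -> 0 < t].
Proof.
move=> Px d0.
have [i0 i0d] : exists i, 0 < dot (a i) d.
  apply: contrapT => h; move/eqP: d0; apply; apply: (hrep_rec hP) => i.
  by rewrite leNgt; apply/negP => hi; apply: h; exists i.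
pose f i := (b i - dot (a i) x) / dot (a i) d.
case: (@arg_minP _ _ _ i0 (fun i => 0 < dot (a i) d) f i0d) => i id mini.
have f0 : 0 <= f i by apply: divr_ge0; [rewrite subr_ge0 hrep_le | apply: ltW].
exists (f i), i; split => //.
- apply/(hrepE hP) => j; rewrite dotDr dotZr.
  case: (ltP 0 (dot (a j) d)) => jd.
    have := mini _ jd; rewrite {2}/f ler_pdivlMr //; lra.
  have := mulr_ge0_le0 f0 jd; have := hrep_le j Px; lra.
- by rewrite /f divfK ?gt_eqF // addrC subrK.
- move=> h; rewrite divr_gt0 // subr_gt0 hrep_lt //.
  by apply/negP => /h; rewrite leNgt id.
Qed.

(** Minkowski's theorem as an induction principle. A non-extreme point slides along some [d] and
    [- d], keeping its tight constraints, until a new one becomes tight on each side; it is a convex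
    combination of the two ends, whose tight sets are larger. *)
Lemma convex_extreme_ind (Phi : pt R -> Prop) x : convex_pred Phi -> P x ->
  (forall v, P v -> extreme v -> tight x \subset tight v -> Phi v) -> Phi x.
Proof.
move=> cPhi.
have [m] := ubnP (n - #|tight x|); elim: m x => // m IH x hm Px hv.
have [ex|nex] := pselect (extreme x); first exact: hv.
have [d [d0 td]] : exists d, d != 0 /\ forall i, i \in tight x -> dot (a i) d = 0.
  apply: contrapT => h; apply: nex => d hd; apply/eqP/negPn/negP => d0.
  by apply: h; exists d.
have step e : e != 0 -> (forall i, i \in tight x -> dot (a i) e = 0) ->
    exists t, 0 < t /\ Phi (x + t *: e).
  move=> e0 te; have [t [i [t0 Pt ie eqi tpos]]] := ray Px e0.
  exists t; split; first by apply: tpos => j /te ->.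
  have sub : tight x \subset tight (x + t *: e).
    apply/fintype.subsetP => j tj; apply/tightP; rewrite dotDr dotZr te //.
    by rewrite mulr0 addr0; apply/tightP.
  have psub : tight x \proper tight (x + t *: e).
    apply/properP; split=> //; exists i; first by apply/tightP; rewrite dotDr dotZr.
    by apply/negP => /te h; rewrite h ltxx in ie.
  apply: IH => // [|v Pv ev sv]; last by apply: hv => //; apply: fintype.subset_trans sub sv.
  have := proper_card psub; have := max_card (tight (x + t *: e)).
  rewrite card_ord => h1 h2; apply: leq_trans (_ : n - #|tight x| <= m)%N => //.
  by rewrite ltn_sub2l // (leq_trans h2).
have [t [t0 Pt]] := step d d0 td.
have [|i /td h|s [s0 Ps]] := step (- d); first by rewrite oppr_eq0.
  by rewrite dotNr h oppr0.
have ts : t + s != 0 by rewrite gt_eqF // addr_gt0.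
have -> : x = (s / (t + s)) *: (x + t *: d) + (t / (t + s)) *: (x + s *: (- d)).
  apply/rowP => i; rewrite !mxE; field; exact: ts.
apply: cPhi => //; rewrite ?divr_ge0 ?addr_ge0 ?ltW //.
by rewrite -mulrDl addrC divff.
Qed.

Lemma extreme_above x : P x ->
  exists v, [/\ P v, extreme v & tight x \subset tight v].
Proof.
move=> Px.
(* A predicate that ignores its point is trivially convex, so the induction yields an existence
   proof. *)
have cP : convex_pred (fun _ : pt R => exists v,
    [/\ P v, extreme v & tight x \subset tight v]).
  by move=> x1 y s t _ _ _ h _.
by apply: (@convex_extreme_ind _ x cP Px) => v Pv ev tv; exists v.
Qed.

Lemma ball_slack z : (forall i, dot (a i) z < b i) ->
  exists r, 0 < r /\ forall y, edist z y < r -> P y.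
Proof.
move=> hz.
have [r [r0 hr]] : exists r, 0 < r /\ forall i, r <= (b i - dot (a i) z) / (1 + nrm (a i)).
  by apply: min_pos => i; rewrite divr_gt0 ?subr_gt0 // ltr_pwDl ?nrm_ge0.
exists r; split=> // y zy; apply/(hrepE hP) => i.
have := hr i; rewrite ler_pdivlMr ?ltr_pwDl ?nrm_ge0 // mulrDr mulr1.
have := dot_le (a i) (y - z); rewrite dotBr -edistE edistC.
have : nrm (a i) * edist z y <= nrm (a i) * r by rewrite ler_wpM2l ?nrm_ge0 ?ltW.
lra.
Qed.

Lemma facet_normal_neq0 i : a i != 0.
Proof.
apply/eqP => a0; have [z hz] := hrep_int hP; have [y [hy _]] := hrep_irr hP i.
by have := hz i; rewrite -hy a0 !dot0l ltxx.
Qed.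

End Hrep.

(** * Facets and supporting planes *)

Section Facets.
Variables (R : realType) (n : nat) (a : 'I_n -> pt R) (b : 'I_n -> R).
Variables (P : set (pt R)) (hP : hrep a b P).
Implicit Types (x y z d w : pt R) (t : R).
Local Notation tight := (tight a b).
Local Notation extreme := (extreme a b).

Definition hfacet i : set (pt R) := [set x | P x /\ dot (a i) x = b i].

Lemma hfacet_face i : hfacet i = [set x | P x /\ forall y, P y -> dot (a i) y <= dot (a i) x].
Proof.
apply/seteqP; split=> x /= [Px h]; split=> //.
  by move=> y Py; rewrite h (hrep_le hP).
have [y [yi yj]] := hrep_irr hP i; apply/eqP; rewrite eq_le (hrep_le hP) //= -yi.
apply: h; apply/(hrepE hP) => j; have [->|/yj/ltW //] := eqVneq j i; by rewrite yi.
Qed.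

Lemma irr_mem i : exists y, [/\ P y, dot (a i) y = b i & forall j, j != i -> dot (a j) y < b j].
Proof.
have [y [yi yj]] := hrep_irr hP i; exists y; split=> //.
by apply/(hrepE hP) => j; have [->|/yj/ltW //] := eqVneq j i; rewrite yi.
Qed.

Lemma facet_slide i y : P y -> dot (a i) y = b i -> (forall j, j != i -> dot (a j) y < b j) ->
  forall d, dot (a i) d = 0 ->
  exists t, [/\ 0 < t, hfacet i (y + t *: d) & hfacet i (y - t *: d)].
Proof.
move=> Py yi yj d di.
have [t [t0 ht]] : exists t, 0 < t /\ forall j,
    t <= if j == i then 1 else (b j - dot (a j) y) / (1 + `|dot (a j) d|).
  apply: min_pos => j; case: eqP => // /eqP ji.
  by rewrite divr_gt0 ?subr_gt0 ?yj // ltr_pwDl.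
have key j : j != i -> t * `|dot (a j) d| <= b j - dot (a j) y.
  move=> ji; have := ht j; rewrite (negPf ji) ler_pdivlMr ?ltr_pwDl //.
  by rewrite mulrDr mulr1; lra.
exists t; split=> //; split; rewrite ?dotl ?di ?mulr0 ?oppr0 ?addr0 //;
  apply/(hrepE hP) => j; rewrite !dotl; have [->|/key h] := eqVneq j i;
  rewrite ?yi ?di ?mulr0 ?oppr0 ?addr0 //.
- have := ler_wpM2l (ltW t0) (ler_norm (dot (a j) d)); lra.
- have := ler_wpM2l (ltW t0) (ler_norm (- dot (a j) d)); rewrite normrN; lra.
Qed.

Lemma two_directions (c : pt R) : exists d e, [/\ dot c d = 0, dot c e = 0 &
  forall s t, s *: d + t *: e = 0 -> s = 0 /\ t = 0].
Proof.
pose N : 'cV[R]_3 := c^T.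
have rk : (2 <= \rank (kermx N))%N.
  by rewrite mxrank_ker leq_subRL ?(leq_trans (rank_leq_col _)) // (leq_add (rank_leq_col N)).
pose B := row_base (kermx N).
have fB : row_free B by apply: row_base_free.
have hB i : dot c (row i B) = 0.
  rewrite dotC dotE -/N.
  have : (row i B <= kermx N)%MS by rewrite -(eq_row_base (kermx N)) row_sub.
  by move/sub_kermxP => ->; rewrite mxE.
pose i0 : 'I_(\rank (kermx N)) := Ordinal (leq_trans (isT : 0 < 2)%N rk).
pose i1 : 'I_(\rank (kermx N)) := Ordinal rk.
exists (row i0 B), (row i1 B); split=> // s t h.
pose u : 'rV[R]_(\rank (kermx N)) := s *: delta_mx 0 i0 + t *: delta_mx 0 i1.
have /rowP e : u = 0.
  by apply: (row_free_inj fB); rewrite mul0mx mulmxDl -!scalemxAl -!rowE.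
by have := e i0; have := e i1; rewrite !mxE !eqxx /= !mulr1 !mulr0 addr0 add0r.
Qed.

Lemma hfacet_noncollinear i : ~ collinear (hfacet i).
Proof.
have [y [Py yi yj]] := irr_mem i.
have [d [e [di ei ind]]] := two_directions (a i).
have [t [t0 tp tm]] := facet_slide Py yi yj di.
have [s [s0 sp sm]] := facet_slide Py yi yj ei.
case=> p [q hq].
have [r0 er0] : exists r, y = p + r *: q by apply: hq.
have [r1 er1] := hq _ tp; have [r2 er2] := hq _ sp.
have e1 : t *: d = (r1 - r0) *: q.
  by rewrite scalerBl; apply: (addrI y); rewrite er1 er0 -addrA [r0 *: q + _]addrC subrK.
have e2 : s *: e = (r2 - r0) *: q.
  by rewrite scalerBl; apply: (addrI y); rewrite er2 er0 -addrA [r0 *: q + _]addrC subrK.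
have [] := ind (t * (r2 - r0)) (- (s * (r1 - r0))).
  by rewrite scaleNr (mulrC t) (mulrC s) -!scalerA e1 e2 !scalerA mulrC subrr.
move=> /eqP; rewrite mulf_eq0 gt_eqF //= => /eqP r20 _.
by have [] := ind 0 s; rewrite ?scale0r ?add0r ?e2 ?r20 ?scale0r // => _ s00; rewrite s00 ltxx in s0.
Qed.

Lemma hfacet_is_facet i : is_facet P (hfacet i).
Proof.
split; last exact: hfacet_noncollinear.
by exists (a i); split; [apply: facet_normal_neq0 hP _ | apply: hfacet_face].
Qed.

(* A point of [F] with fewest tight constraints: by averaging, its tight
   constraints are tight on all of [F]. *)
Lemma face_tight F : is_face P F -> exists i, F `<=` hfacet i.
Proof.
(* An index is needed for the case of an empty [F]; without any, every vector would be a recession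
   direction. *)
have [i0 _] : exists i : 'I_n, True.
  apply: contrapT => h; have /rowP/(_ 0)/eqP : const_mx 1 = 0 :> pt R.
    by apply: (hrep_rec hP) => i; case: h; exists i.
  by rewrite !mxE oner_eq0.
case=> c [c0 FE]; have [[x0 Fx0]|F0] := pselect (exists x, F x); last first.
  by exists i0 => x Fx; case: F0; exists x.
pose G : set (pt R) := [set x | P x /\ forall y, P y -> dot c y <= dot c x].
have {FE} FG : F = G by [].
rewrite FG; rewrite {}FG in Fx0.
have [m mP] : exists m, (exists x, G x /\ #|tight x| = m) /\
    forall x, G x -> (m <= #|tight x|)%N.
  pose p m := `[< exists x, G x /\ #|tight x| = m >].
  have ep : exists m, p m by exists #|tight x0|; apply/asboolP; exists x0.
  exists (ex_minn ep); case: ex_minnP => m /asboolP hm hmin; split=> // x Gx.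
  by apply: hmin; apply/asboolP; exists x.
case: mP => -[x [Gx xm]] mmin.
have sub y : G y -> tight x \subset tight y.
  move=> Gy; have [Px xmax] := Gx; have [Py ymax] := Gy.
  have h0 : (0 : R) <= 2^-1 by rewrite invr_ge0.
  have Pz : P (2^-1 *: x + 2^-1 *: y).
    by apply: (hrep_convex hP) => //; lra.
  have Gz : G (2^-1 *: x + 2^-1 *: y).
    split=> // z Pz'; rewrite !dotl; have := xmax _ Pz'; have := ymax _ Pz'; lra.
  have sz u : (u \in tight (2^-1 *: x + 2^-1 *: y)) -> (u \in tight x) /\ (u \in tight y).
    move/tightP; rewrite !dotl => h.
    have := hrep_le hP u Px; have := hrep_le hP u Py => h1 h2.
    by split; apply/tightP; lra.
  have := mmin _ Gz; rewrite -xm => hle.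
  have sx : tight (2^-1 *: x + 2^-1 *: y) \subset tight x.
    by apply/fintype.subsetP => u /sz [].
  have /eqP <- : tight (2^-1 *: x + 2^-1 *: y) == tight x by rewrite eqEcard sx.
  by apply/fintype.subsetP => u /sz [].
(* With no tight constraint [x] would be interior, and a step along [c] would increase [dot c]. *)
have [i ti] : exists i, i \in tight x.
  apply: contrapT => h.
  have hx j : dot (a j) x < b j.
    by apply: (hrep_lt hP); [case: Gx | apply/negP => hj; apply: h; exists j].
  have [r [r0 hr]] := ball_slack hP hx.
  have nc : 0 < nrm c by rewrite nrm_gt0.
  have q0 : 0 < r / 2 / nrm c by rewrite !divr_gt0.
  have Pq : P (x + (r / 2 / nrm c) *: c).
    apply: hr; exact: edist_step.
  have := proj2 Gx _ Pq; rewrite dotDr dotZr.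
  have : 0 < r / 2 / nrm c * dot c c by rewrite mulr_gt0 ?dot_gt0.
  lra.
exists i => y Gy; split; first by case: Gy.
by apply/tightP; apply: (fintype.subsetP (sub _ Gy)).
Qed.

End Facets.

(** * Cells in terms of the inequalities *)

Section Cells.
Variables (R : realType) (n : nat) (a : 'I_n -> pt R) (b : 'I_n -> R).
Variables (P : set (pt R)) (hP : hrep a b P).
Implicit Types (x y z d w : pt R) (t : R).
Local Notation tight := (tight a b).
Local Notation extreme := (extreme a b).
Local Notation hfacet := (hfacet a b P).

Lemma parallel_or_collinear (u c : pt R) (s t : R) : u != 0 ->
  (exists l, c = l *: u) \/ collinear [set x | dot u x = s /\ dot c x = t].
Proof.
move=> u0; pose M := col_mx u c.
have [fM|] := boolP (row_free M); last first.
  rewrite -kermx_eq0 => /rowV0Pn [k /sub_kermxP kM k0]; left.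
  have {kM} e : k 0 (lshift 1 0) *: u + k 0 (rshift 1 0) *: c = 0.
    move: kM; rewrite -{1}[k]hsubmxK mul_row_col [lsubmx k]mx11_scalar.
    by rewrite [rsubmx k]mx11_scalar !mul_scalar_mx !mxE.
  have k1 : k 0 (rshift 1 0) != 0.
    apply: contraNneq k0 => k10; apply/eqP/rowP => i; rewrite mxE.
    move/eqP: e; rewrite k10 scale0r addr0 scaler_eq0 (negPf u0) orbF => /eqP k00.
    by case: (split_ordP i) => j ->; rewrite ord1.
  exists (- (k 0 (lshift 1 0)) / k 0 (rshift 1 0)).
  apply: (scalerI k1); rewrite scalerA mulrCA divff // mulr1 scaleNr.
  by apply/eqP; rewrite -addr_eq0 addrC e.
right; have [[p [pu pc]]|] := pselect (exists x, dot u x = s /\ dot c x = t); last first.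
  by move=> h; exists 0, 0 => x [h1 h2]; case: h; exists x.
pose K := kermx M^T.
have rK : \rank K = 1%N by rewrite mxrank_ker mxrank_tr (eqP fM).
pose d := nz_row K; exists p, d => x [xu xc].
have d0 : d != 0 by rewrite nz_row_eq0 -mxrank_eq0 rK.
have Kd : (K <= d)%MS.
  by have := mxrank_leqif_sup (nz_row_sub K) => /leqifP; rewrite rK rank_rV d0; case: ifP.
have xK : (x - p <= K)%MS.
  apply/sub_kermxP; rewrite /M tr_col_mx mul_mx_row.
  have e (y : pt R) : dot y (x - p) = 0 -> (x - p) *m y^T = 0.
    by move=> h; rewrite [LHS]mx11_scalar -dotE dotC h; apply: raddf0.
  by rewrite !e ?row_mx0 // dotBr ?xu ?xc ?pu ?pc subrr.
have /sub_rVP [r hr] := submx_trans xK Kd.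
by exists r; rewrite -hr addrC subrK.
Qed.

(** Were the supporting normal [c] of a facet inside [hfacet i] not parallel to [a i], the facet
    would lie in two transversal planes, hence on a line. So [c] is constant on plane [i], which
    gives the reverse inclusion. *)
Lemma facetP F : is_facet P F <-> exists i, F = hfacet i.
Proof.
split=> [[fF ncF]|[i ->]]; last exact: hfacet_is_facet.
have [i Fi] := face_tight hP fF; exists i; apply/seteqP; split=> // x [Px xi].
case: fF => c [c0 FE].
have [y Fy] : exists y, F y.
  by apply: contrapT => h; apply: ncF; exists 0, 0 => y Fy; case: h; exists y.
have [Py ymax] : P y /\ forall z, P z -> dot c z <= dot c y by move: Fy; rewrite FE.
have [[l cl]|col] := parallel_or_collinear c (b i) (dot c y) (facet_normal_neq0 hP i); last first.
  case: ncF; case: col => p [d h]; exists p, d => z Fz; apply: h; split.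
    by case: (Fi _ Fz).
  by move: Fz; rewrite FE => -[Pz zmax]; apply/eqP; rewrite eq_le zmax // ymax.
have yi : dot (a i) y = b i by case: (Fi _ Fy).
by rewrite FE; split=> // z Pz; rewrite (_ : dot c x = dot c y) ?ymax // cl !dotZl xi yi.
Qed.

Lemma hfacet_inj : injective hfacet.
Proof.
move=> i j ij; have [y [Py yi yj]] := irr_mem hP i.
have [_ /eqP] : hfacet j y by rewrite -ij.
by apply: contraTeq => ji; rewrite lt_eqF // yj // eq_sym.
Qed.

Lemma hrep_has_n_facets : has_n_facets P n.
Proof. by exists hfacet; split; [apply: hfacet_inj | apply: facetP]. Qed.

Lemma has_n_facets_uniq m : has_n_facets P m -> m = n.
Proof.
case=> f [finj hf].
have h1 i : exists j, f i = hfacet j by apply/facetP/hf; exists i.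
have h2 j : exists i, hfacet j = f i by apply/hf/facetP; exists j.
have [g hg] := choice h1; have [k hk] := choice h2.
apply/eqP; rewrite eqn_leq; apply/andP; split.
  rewrite -[m in (m <= _)%N]card_ord -[n in (_ <= n)%N]card_ord.
  by apply: (@leq_card _ _ g) => i j ij; apply: finj; rewrite !hg ij.
rewrite -[n in (n <= _)%N]card_ord -[m in (_ <= m)%N]card_ord.
by apply: (@leq_card _ _ k) => i j ij; apply: hfacet_inj; rewrite !hk ij.
Qed.

(* Each extreme point is recovered from its tight set, so finitely many
   generators suffice; the other indices get a default point of [P]. *)
Lemma hrep_conv_hull : exists k (v : 'I_k -> pt R), P = conv_hull v.
Proof.
have [z hz] := hrep_int hP.
have Pz : P z by apply/(hrepE hP) => i; apply: ltW.
have hS (S : {set 'I_n}) : exists v, P v /\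
    forall w, P w -> extreme w -> tight w = S -> v = w.
  have [[w [Pw ew tw]]|nw] := pselect (exists w, [/\ P w, extreme w & tight w = S]).
    by exists w; split=> // w' Pw' ew' tw'; apply: extreme_inj ew _; rewrite tw tw'.
  by exists z; split=> // w Pw ew tw; case: nw; exists w.
have [v hv] := choice hS.
exists #|{: {set 'I_n}}|, (fun i => v (enum_val i)); apply/seteqP; split=> x.
  move=> Px; apply: (convex_extreme_ind hP) Px _; first exact: conv_hull_convex.
  move=> w Pw ew _; have := conv_hull_gen (fun i => v (enum_val i)) (enum_rank (tight w)).
  by rewrite enum_rankK (proj2 (hv _) w).
move=> hx; apply/(hrepE hP) => i; apply: conv_hull_le hx => j.
by apply: (hrep_le hP); case: (hv (enum_val j)).
Qed.

Lemma hrep_M : M_ n P.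
Proof.
split; last exact: hrep_has_n_facets.
split; first exact: hrep_conv_hull.
have [z hz] := hrep_int hP; have [r [r0 hr]] := ball_slack hP hz.
by exists z, r.
Qed.

(** The sum of the tight normals exposes [v]: it is maximal only where every summand is, and
    extremality leaves only [v]. *)
Lemma extreme_vertex v : P v -> extreme v -> is_vertex P [set v].
Proof.
move=> Pv ev; split; last by exists v.
pose c := \sum_(i in tight v) a i.
have cle y : P y -> dot c y <= dot c v.
  move=> Py; rewrite /c !dot_suml; apply: ler_sum => i /tightP ->; exact: (hrep_le hP).
have ceq y : P y -> dot c y = dot c v -> y = v.
  move=> Py; rewrite /c !dot_suml => e; apply/eqP; rewrite -subr_eq0; apply/eqP.
  apply: ev => i ti; rewrite dotBr; apply/eqP; rewrite subr_eq0; apply/eqP.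
  have h : \sum_(i in tight v) (dot (a i) v - dot (a i) y) = 0 by rewrite sumrB e subrr.
  apply/eqP; rewrite eq_sym -subr_eq0; move/eqP: h; rewrite psumr_eq0 => [/allP|j /tightP ->].
    by move/(_ i (mem_index_enum _)); rewrite ti.
  by rewrite subr_ge0 (hrep_le hP).
exists c; split.
  apply/eqP => c0; have [z hz] := hrep_int hP; have [r [r0 hr]] := ball_slack hP hz.
  have hv y : P y -> y = v by move=> Py; apply: ceq; rewrite // c0 !dot0l.
  have u0 : (const_mx 1 : pt R) != 0.
    by apply/eqP => /rowP/(_ 0); rewrite !mxE; apply/eqP; apply: oner_neq0.
  pose q := z + (r / 2 / nrm (const_mx 1)) *: const_mx 1.
  have Pq : P q.
    apply: hr; exact: edist_step.
  have Pz : P z by apply: hr; rewrite edistxx.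
  have : q - z = 0 by rewrite (hv _ Pq) (hv _ Pz) subrr.
  rewrite /q addrC addKr => /eqP; rewrite scaler_eq0 (negPf u0) orbF gt_eqF //.
  by rewrite !divr_gt0 ?nrm_gt0.
apply/seteqP; split=> [x -> |x [Px h]]; first by split.
by apply: ceq => //; apply/eqP; rewrite eq_le cle //= h.
Qed.

End Cells.

(** * Polyhedra as intersections of their facet half-spaces *)

Section FourierMotzkin.
Variable R : realType.
Implicit Types (x y z : pt R) (s t : R).

Lemma seq_max0 (s : seq R) : exists t, [/\ 0 <= t, forall u : R, u \in s -> u <= t &
  t = 0 \/ t \in s].
Proof.
elim: s => [|u s [t [t0 tmax tin]]]; first by exists 0; split=> //; left.
case: (leP u t) => [ut|tu].
  exists t; split=> // [x|]; first by rewrite in_cons => /predU1P[->|/tmax].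
  by case: tin => [->|ts]; [left | right; rewrite in_cons ts orbT].
exists u; split=> [|x|]; first exact: le_trans (ltW tu).
  by rewrite in_cons => /predU1P[->|/tmax/le_trans]; last by apply; apply: ltW.
by right; rewrite mem_head.
Qed.

(** Constraints with [be < 0] bound [t] from below, those with [be > 0] from above. The right-hand
    side compares 0 and every lower bound with every upper bound; the witness is the largest lower
    bound. *)
Lemma fourier_motzkin (T : eqType) (C : seq T) (al be : T -> R) :
  (exists t, 0 <= t /\ forall c, c \in C -> al c + t * be c <= 0) <->
  (forall c, c \in C -> 0 <= be c -> al c <= 0) /\
  (forall c d, c \in C -> d \in C -> 0 < be c -> be d < 0 ->
     be c * al d - be d * al c <= 0).
Proof.
split=> [[t [t0 ht]]|[h1 h2]].
  split=> [c cC b0|c d cC dC c0 d0].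
    have := ht c cC; have := mulr_ge0 t0 b0; lra.
  have := ler_wpM2l (ltW c0) (ht d dC).
  have := ler_wnM2l (ltW d0) (ht c cC); lra.
have [t [t0 tmax tin]] := seq_max0 [seq al d / - be d | d <- C & be d < 0].
exists t; split=> // c cC.
case: (ltgtP (be c) 0) => [bc|bc|bc].
- have : al c / - be c <= t by apply: tmax; apply/mapP; exists c; rewrite ?mem_filter ?bc.
  by rewrite ler_pdivrMr ?oppr_gt0 //; lra.
- case: tin => [->|/mapP[d]]; first by rewrite mul0r addr0; apply: h1; rewrite ?ltW.
  rewrite mem_filter => /andP[bd dC] ->.
  rewrite -(@pmulr_rle0 _ (- be d)) ?oppr_gt0 //.
  have := h2 c d cC dC bc bd.
  rewrite mulrDr mulrA mulrCA divff ?mulr1 ?oppr_eq0 ?lt_eqF //; lra.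
- by rewrite bc mulr0 addr0; apply: h1; rewrite ?bc.
Qed.

(** Homogenised inequalities for the cone over a hull; [s] is the total weight, and [s = 1] recovers
    the hull. *)
Definition sat (C : seq (pt R * R)) x s := forall c, c \in C -> dot c.1 x <= c.2 * s.

(** Induction on the generators: the weight [t >= 0] of a new generator is one more variable, which
    Fourier-Motzkin elimination removes. Homogeneity allows splitting off one weight at a time. *)
Lemma cone_hrep k (v : 'I_k -> pt R) : exists C, forall x s, sat C x s <->
  exists l : 'I_k -> R, (forall i, 0 <= l i) /\ \sum_(i < k) l i = s /\
    x = \sum_(i < k) l i *: v i.
Proof.
elim: k v => [|k IH] v.
  exists ((0, 1) :: (0, -1) :: [seq (delta_mx 0 i, 0) | i <- enum 'I_3] ++
          [seq (- delta_mx 0 i, 0) | i <- enum 'I_3]).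
  move=> x s; split=> [h|[l [_ []]]]; last first.
    rewrite !big_ord0 => <- -> c _; by rewrite dot0r mulr0.
  have dx i : dot (delta_mx 0 i) x = x 0 i.
    by rewrite dotE -rowE mxE mxE.
  exists (fun=> 0); split=> //; rewrite !big_ord0; split.
    have := h (0, 1); rewrite !inE eqxx /= dot0l mul1r => /(_ isT).
    have := h (0, -1); rewrite !inE eqxx orbT /= dot0l mulN1r => /(_ isT).
    lra.
  apply/rowP => i; rewrite mxE.
  have := h (delta_mx 0 i, 0); rewrite !inE mem_cat map_f ?mem_enum // ?orbT /= => /(_ isT).
  have := h (- delta_mx 0 i, 0); rewrite !inE mem_cat.
  rewrite (map_f (fun i => (- delta_mx 0 i, 0))) ?mem_enum // ?orbT /= => /(_ isT).
  rewrite dotNl dx mul0r; lra.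
have [C hC] := IH (fun i => v (lift ord0 i)).
(* The coefficient of [t] when constraint [c] is written at [x - t *: v ord0] and [s - t]. *)
pose be (c : pt R * R) := c.2 - dot c.1 (v ord0).
exists ([seq c <- C | 0 <= be c] ++
  [seq (be c *: d.1 - be d *: c.1, be c * d.2 - be d * c.2) |
    c <- [seq c <- C | 0 < be c], d <- [seq d <- C | be d < 0]]).
move=> x s.
apply: (@iff_trans _ (exists t, 0 <= t /\ sat C (x - t *: v ord0) (s - t))); last first.
  split=> [[t [t0 /hC [l [l0 [ls lx]]]]]|[l [l0 [ls lx]]]].
    exists (fun i => if unlift ord0 i is Some j then l j else t); split.
      by move=> i; case: unlift.
    rewrite !big_ord_recl unlift_none; split.
      under eq_bigr do rewrite liftK; by rewrite ls addrC subrK.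
    under eq_bigr do rewrite liftK; by rewrite -lx addrC subrK.
  exists (l ord0); split=> //; apply/hC; exists (fun i => l (lift ord0 i)); split=> //.
  by split; [rewrite -ls | rewrite lx]; rewrite big_ord_recl addrC addKr.
apply: (@iff_trans _ (exists t, 0 <= t /\ forall c, c \in C ->
   (dot c.1 x - c.2 * s) + t * be c <= 0)); last first.
  by split=> -[t [t0 h]]; exists t; split=> // c /h; rewrite /be dotBr dotZr; lra.
apply: iff_trans (iff_sym (fourier_motzkin _ _ _)); split=> [h|[h1 h2] c].
  split=> [c cC bc|c d cC dC bc bd].
    have := h c; rewrite mem_cat mem_filter bc cC => /(_ isT); lra.
  have := h (be c *: d.1 - be d *: c.1, be c * d.2 - be d * c.2).
  rewrite mem_cat orbC.
  rewrite (allpairs_f (fun c d => (be c *: d.1 - be d *: c.1, be c * d.2 - be d * c.2)))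
    ?mem_filter ?bc ?bd // => /(_ isT) /=.
  rewrite !dotl; lra.
rewrite mem_cat mem_filter => /orP[/andP[bc cC]|/allpairsP[[c1 d1] /= []]].
  have := h1 c cC bc; lra.
rewrite !mem_filter => /andP[bc cC] /andP[bd dC] ->.
have := h2 _ _ cC dC bc bd; rewrite !dotl /=; lra.
Qed.

Definition halfspaces m (P : set (pt R)) := exists (a : 'I_m -> pt R) (b : 'I_m -> R),
  forall x, P x <-> forall i, dot (a i) x <= b i.

Lemma conv_hull_halfspaces k (v : 'I_k -> pt R) : exists m, halfspaces m (conv_hull v).
Proof.
have [C hC] := cone_hrep v.
exists (size C), (fun i => (tnth (in_tuple C) i).1), (fun i => (tnth (in_tuple C) i).2).
move=> x; have [h1 h2] := hC x 1; split=> [hx i|h].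
  by have := h2 hx _ (mem_tnth i (in_tuple C)); rewrite mulr1.
by apply: h1 => c /(tnthP (in_tuple C)) [i ->]; rewrite mulr1.
Qed.

(** A description by the fewest half-spaces is irredundant: for each [i] some point violates
    constraint [i] alone. *)
Lemma polyhedron_hrep P : is_polyhedron P ->
  exists m (a : 'I_m -> pt R) (b : 'I_m -> R), hrep a b P.
Proof.
case=> -[k [v Pv]] [z [r [r0 hr]]].
have [m hm mmin] : exists2 m, halfspaces m P & forall m', halfspaces m' P -> (m <= m')%N.
  have ep : exists m, `[< halfspaces m P >].
    by have [m hm] := conv_hull_halfspaces v; exists m; apply/asboolP; rewrite Pv.
  case: (ex_minnP ep) => m /asboolP hm hmin; exists m => // m' hm'.
  by apply: hmin; apply/asboolP.
exists m; case: hm => a [b hab]; exists a, b.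
have Pz : P z by apply: hr; rewrite edistxx.
have irr i : exists x, b i < dot (a i) x /\ forall j, j != i -> dot (a j) x <= b j.
  apply: contrapT => h; case: m a b hab mmin i h => [|m] a b hab mmin i h; first by case: i h.
  suff /mmin : halfspaces m P by rewrite ltnn.
  exists (fun j => a (lift i j)), (fun j => b (lift i j)) => x.
  split=> [/hab hx j //|hx]; apply/hab => j.
  case: (unliftP i j) => [j' ->//|->]; rewrite leNgt; apply/negP => hi; apply: h.
  exists x; split=> // j' ji; case: (unliftP i j') ji => [j'' ->//|->].
  by rewrite eqxx.
have a0 i : a i != 0.
  apply/eqP => ai; have [x []] := irr i; rewrite ai dot0l => bi _.
  by move/hab: Pz => /(_ i); rewrite ai dot0l leNgt bi.
have zlt i : dot (a i) z < b i.
  have n0 : 0 < nrm (a i) by rewrite nrm_gt0.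
  have q0 : 0 < r / 2 / nrm (a i) by rewrite !divr_gt0.
  have /hab/(_ i) : P (z + (r / 2 / nrm (a i)) *: a i).
    apply: hr; exact: edist_step.
  rewrite dotDr dotZr; have : 0 < r / 2 / nrm (a i) * dot (a i) (a i) by rewrite mulr_gt0 ?dot_gt0.
  lra.
split=> //; first by exists z.
- move=> i; have [x [xi xj]] := irr i.
  (* Where the segment from the interior point [z] to [x] crosses plane [i]; the weight [1 - t] of
     [z] keeps the other constraints strict. *)
  pose t := (b i - dot (a i) z) / (dot (a i) x - dot (a i) z).
  have p0 : 0 < b i - dot (a i) z by rewrite subr_gt0.
  have p1 : 0 < dot (a i) x - dot (a i) z by lra.
  have t0 : 0 < t by rewrite divr_gt0.
  have t1 : t < 1 by rewrite ltr_pdivrMr // mul1r; lra.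
  exists (z + t *: (x - z)); rewrite !dotl; split.
    by rewrite /t divfK ?gt_eqF // addrC subrK.
  move=> j ji; rewrite !dotl.
  have : (1 - t) * dot (a j) z < (1 - t) * b j by rewrite ltr_pM2l // subr_gt0.
  have := ler_wpM2l (ltW t0) (xj j ji); lra.
- move=> d hd; apply/eqP; rewrite -dot_eq0; apply/negPn/negP => d0.
  have d1 : 0 < dot d d by rewrite lt_def d0 dot_ge0.
  have [M [M0 hM]] := max_fin (fun i => dot d (v i)).
  (* Large enough for [dot d] at [z + t *: d] to exceed [M], its bound on the hull. *)
  pose t := (M + `|dot d z| + 1) / dot d d.
  have t0 : 0 <= t by rewrite divr_ge0 ?dot_ge0 // !addr_ge0 // ltW.
  have Pt : P (z + t *: d).
    apply/hab => i; rewrite dotDr dotZr.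
    have := mulr_ge0_le0 t0 (hd i); have := zlt i; lra.
  rewrite Pv in Pt; have := conv_hull_le hM Pt.
  rewrite dotDr dotZr /t divfK //; have := ler_norm (- dot d z); rewrite normrN; lra.
Qed.

Lemma M_hrep n P : M_ n P -> exists (a : 'I_n -> pt R) (b : 'I_n -> R), hrep a b P.
Proof.
case=> /polyhedron_hrep [m [a [b h]]] /(has_n_facets_uniq h) nm; subst n.
by exists a, b.
Qed.

End FourierMotzkin.

(** * Rigidity of simple polyhedra *)

Section Frames.
Variables (R : realType) (n : nat) (a : 'I_n -> pt R) (b : 'I_n -> R).
Variables (P : set (pt R)) (hP : hrep a b P).
Implicit Types (x y w : pt R).
Local Notation tight := (tight a b).
Local Notation extreme := (extreme a b).

(* The edge directions at a vertex lying on exactly three facets; they form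
   minus the dual basis of the three facet normals. *)
Record frame w (e : 'I_3 -> 'I_n) (d : 'I_3 -> pt R) : Prop := Frame {
  frame_tight : forall i, i \in tight w <-> exists c, i = e c;
  frame_dual : forall c c', dot (a (e c)) (d c') = - (c == c')%:R;
  frame_coord : forall x, x = \sum_c (- dot (a (e c)) x) *: d c }.

(** The tight normals at an extreme point span, so there are at least three; being at most three,
    they form an invertible matrix, and minus the rows of its inverse are the edge directions. *)
Lemma simple_frame w : extreme w -> (#|tight w| <= 3)%N ->
  exists e d, frame w e d.
Proof.
move=> ew w3.
have free m (e : 'I_m -> 'I_n) : (forall i, i \in tight w -> exists c, i = e c) ->
    row_free (\matrix_(i, j) a (e j) 0 i : 'M_(3, m)).
  move=> he; rewrite -kermx_eq0; apply/rowV0P => d /sub_kermxP dN.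
  apply: ew => i /he [c ->]; move/rowP/(_ c): dN; rewrite !mxE => <-.
  by rewrite dotC; apply: eq_bigr => j _; rewrite mxE.
have m3 : #|tight w| = 3%N.
  apply/eqP; rewrite eqn_leq w3 /=.
  have /eqP <- := free _ (fun j => enum_val j) (fun i ti =>
    ex_intro _ (enum_rank_in ti i) (esym (enum_rankK_in ti ti))).
  exact: rank_leq_col.
pose e (c : 'I_3) : 'I_n := enum_val (cast_ord (esym m3) c).
have he i : i \in tight w -> exists c, i = e c.
  move=> ti; exists (cast_ord m3 (enum_rank_in ti i)).
  by rewrite /e cast_ordK enum_rankK_in.
have {free} := free _ e he; set N := (X in row_free X).
rewrite row_free_unit => uN.
have dN x c : (x *m N) 0 c = dot (a (e c)) x.
  by rewrite dotC mxE; apply: eq_bigr => j _; rewrite mxE.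
exists e, (fun c => - row c (invmx N)); split.
- by move=> i; split=> [/he //|[c ->]]; apply: enum_valP.
- by move=> c c'; rewrite dotNr -dN -row_mul mulVmx // !mxE eq_sym.
- move=> x; rewrite -{1}[x](mulmxK uN) mulmx_sum_row; apply: eq_bigr => c _.
  by rewrite dN scaleNr scalerN opprK.
Qed.

Lemma frame_tight_mem w e d c : frame w e d -> dot (a (e c)) w = b (e c).
Proof. by move=> fr; apply/tightP/(frame_tight fr); exists c. Qed.

(** The ray along [d c] stays on the other two facets and stops at a plane [l] transversal to it;
    the three normals leave no free direction. *)
Lemma frame_neighbor w e d c : P w -> frame w e d -> exists t,
  [/\ 0 < t, P (w + t *: d c), extreme (w + t *: d c) &
      forall c', c' != c -> e c' \in tight (w + t *: d c)].
Proof.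
move=> Pw fr.
have d0 : d c != 0.
  apply/eqP => dc; have /eqP := frame_dual fr c c.
  by rewrite dc dot0r eqxx eq_sym oppr_eq0 oner_eq0.
have [t [l [t0 Pt ld le tpos]]] := ray hP Pw d0.
have sub c' : c' != c -> e c' \in tight (w + t *: d c).
  move=> cc; apply/tightP; rewrite dotDr dotZr (frame_dual fr) (negPf cc).
  by rewrite oppr0 mulr0 addr0 (frame_tight_mem _ fr).
exists t; split=> //.
- apply: tpos => j /(frame_tight fr) [c' ->]; rewrite (frame_dual fr).
  by rewrite oppr_le0 ler0n.
- move=> x hx.
  have E : x = (- dot (a (e c)) x) *: d c.
    rewrite {1}(frame_coord fr x) (bigD1 c) //= big1 ?addr0 // => c' cc.
    by rewrite hx ?sub // oppr0 scale0r.
  have : dot (a l) x = 0 by apply: hx; apply/tightP; rewrite dotDr dotZr.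
  rewrite E dotZr => /eqP; rewrite mulf_eq0 (gt_eqF ld) orbF => /eqP ->.
  by rewrite scale0r.
Qed.

Definition ap (f : 'M[R]_3 * pt R) x := amap f.1 f.2 x.

Lemma apD f x y : ap f (x + y) = ap f x + y *m f.1.
Proof. by rewrite /ap /amap mulmxDl -!addrA [f.2 + _]addrC. Qed.

(** Agreement is asked on whole facet planes, so that it can be tested on edge directions and
    carried along an edge. *)
Definition agree w (F : 'I_n -> 'M[R]_3 * pt R) f :=
  forall i, i \in tight w -> forall x, dot (a i) x = b i -> ap f x = ap (F i) x.

Variable F : 'I_n -> 'M[R]_3 * pt R.
Hypothesis F_vertex : forall i j v, P v -> extreme v ->
  i \in tight v -> j \in tight v -> ap (F i) v = ap (F j) v.

(** The maps of two facets along an edge agree at both its ends, so their linear parts agree on its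
    direction; [f] is then prescribed on the basis [d]. *)
Lemma frame_agree w e d : P w -> extreme w -> frame w e d ->
  exists f, agree w F f.
Proof.
move=> Pw ew fr.
have wt c : e c \in tight w by apply/(frame_tight fr); exists c.
have dir c c1 c2 : c1 != c -> c2 != c -> d c *m (F (e c1)).1 = d c *m (F (e c2)).1.
  move=> h1 h2; have [t [t0 Pt et tt]] := frame_neighbor c Pw fr.
  have := F_vertex Pt et (tt _ h1) (tt _ h2).
  rewrite !apD (F_vertex Pw ew (wt c1) (wt c2)) => /addrI.
  by rewrite -!scalemxAl => /scalerI; apply; rewrite gt_eqF.
(* Direction [d c] lies in the facets other than [e c]; [c + 1], cyclic in ['I_3], picks one of
   them. *)
pose q c := d c *m (F (e (c + 1))).1.
pose A : 'M[R]_3 := \sum_c - ((a (e c))^T *m q c).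
have hA x : x *m A = \sum_c (- dot (a (e c)) x) *: q c.
  rewrite mulmx_sumr; apply: eq_bigr => c _.
  rewrite mulmxN mulmxA [x *m _]mx11_scalar mul_scalar_mx -dotE dotC.
  by rewrite scaleNr.
exists (A, ap (F (e 0)) w - w *m A) => i /(frame_tight fr) [c ->] x xc.
have -> : x = w + (x - w) by rewrite addrC subrK.
rewrite !apD /= {1}/ap /amap /= [w *m A + _]addrC subrK.
rewrite (F_vertex Pw ew (wt 0) (wt c)); congr (_ + _).
rewrite hA {2}(frame_coord fr (x - w)) mulmx_suml; apply: eq_bigr => c' _.
have [->|cc] := eqVneq c' c.
  by rewrite dotBr xc (frame_tight_mem _ fr) subrr oppr0 !scale0r mul0mx.
have c1 : c' + 1 != c' by case: (c') => -[|[|[|]]].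
by rewrite -scalemxAl (dir c' c (c' + 1)) // eq_sym.
Qed.

(** Each of the three edge directions at [w] lies in at least one of two distinct facet planes. *)
Lemma frame_uniq w e d c1 c2 f g : frame w e d -> c1 != c2 ->
  (forall c, c = c1 \/ c = c2 -> forall x, dot (a (e c)) x = b (e c) -> ap f x = ap g x) ->
  forall x, ap f x = ap g x.
Proof.
move=> fr c12 h.
have fw : ap f w = ap g w by apply: (h c1); [left | apply: frame_tight_mem fr].
have dir c : d c *m f.1 = d c *m g.1.
  have [c' [hc' cc]] : exists c', (c' = c1 \/ c' = c2) /\ c' != c.
    have [cc|cc] := eqVneq c1 c; last by exists c1; split=> //; left.
    by exists c2; split; [right | rewrite -cc eq_sym].
  have := h c' hc' (w + d c); rewrite !apD fw => hh; apply: (addrI (ap g w)); apply: hh.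
  by rewrite dotDr (frame_dual fr) (negPf cc) oppr0 addr0 (frame_tight_mem _ fr).
move=> x; have -> : x = w + (x - w) by rewrite addrC subrK.
rewrite !apD fw; congr (_ + _); rewrite (frame_coord fr (x - w)) !mulmx_suml.
by apply: eq_bigr => c _; rewrite -!scalemxAl dir.
Qed.

Hypothesis simple : forall x, P x -> (#|tight x| <= 3)%N.

(* Simplex path: from any vertex other than [v], some edge increases the
   functional which is maximal exactly at [v]; the two facets along this edge
   force the agreement to propagate. *)
Lemma agree_everywhere v f : P v -> extreme v -> agree v F f ->
  forall w, P w -> extreme w -> agree w F f.
Proof.
move=> Pv ev fv.
pose c := \sum_(i in tight v) a i.
(* The induction counts the vertices strictly above [w], recorded by their tight sets, which
   determine them and live in a finite type. *)
pose above w : {set {set 'I_n}} :=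
  finset (fun S => `[< exists x, [/\ P x, extreme x, tight x = S & dot c w < dot c x] >]).
move=> w; have [m] := ubnP #|above w|; elim: m w => // m IH w hm Pw ew.
have [<-//|vw] := eqVneq v w.
have [e [d fr]] := simple_frame ew (simple Pw).
have cvw : 0 < dot c (v - w).
  have h i : i \in tight v -> 0 <= dot (a i) (v - w).
    by move=> /tightP ti; rewrite dotBr ti subr_ge0 (hrep_le hP).
  rewrite lt_def; apply/andP; split; last by rewrite /c dot_suml sumr_ge0.
  apply/eqP; rewrite /c dot_suml => /eqP; rewrite psumr_eq0 // => /allP hz.
  move/eqP: vw; apply; apply/eqP; rewrite -subr_eq0; apply/eqP; apply: ev => i ti.
  by have := hz i (mem_index_enum _); rewrite ti => /eqP.
(* [v - w] is a nonnegative combination of the edge directions at [w], so one of them increases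
   [dot c]. *)
have [k dk] : exists k, 0 < dot c (d k).
  apply: contrapT => hk; move: cvw; rewrite (frame_coord fr (v - w)) dot_sumr.
  apply/negP; rewrite -leNgt; apply: sumr_le0 => k _; rewrite dotZr.
  apply: mulr_ge0_le0; last by rewrite leNgt; apply/negP => h; apply: hk; exists k.
  by rewrite dotBr (frame_tight_mem _ fr) opprB subr_ge0 (hrep_le hP).
have [t [t0 Pp ep tp]] := frame_neighbor k Pw fr.
set p := w + t *: d k in Pp ep tp.
have cwp : dot c w < dot c p by rewrite dotDr dotZr ltrDl mulr_gt0.
have fp : agree p F f.
  apply: IH => //; rewrite -ltnS; apply: leq_trans hm; rewrite ltnS.
  apply: proper_card; apply/properP; split.
    apply/fintype.subsetP => S; rewrite [S \in _]inE [S \in above w]inE.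
    move=> /asboolP [x [Px ex tx lx]].
    by apply/asboolP; exists x; split=> //; apply: lt_trans lx.
  exists (tight p); first by rewrite [tight p \in _]inE; apply/asboolP; exists p.
  apply/negP; rewrite [tight p \in _]inE => /asboolP [x [Px ex tx lx]].
  by move: lx; rewrite (extreme_inj ex tx) ltxx.
have [g gw] := frame_agree Pw ew fr.
have fg : forall x, ap f x = ap g x.
  (* Cyclically, [k + 1] and [k + 2] index the two facets along the edge from [w] to [p]. *)
  apply: (@frame_uniq w e d (k + 1) (k + 2%:R) f g fr).
    by case: k {dk tp p Pp ep cwp fp} => -[|[|[|]]].
  move=> k' hk' x xk'.
  have kk : k' != k by case: hk' => ->; case: k {dk tp p Pp ep cwp fp} => -[|[|[|]]].
  rewrite (fp _ (tp _ kk)) // (gw (e k')) //.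
  by apply/(frame_tight fr); exists k'.
by move=> i ti x xi; rewrite fg; apply: gw.
Qed.

End Frames.

Section Rigidity.
Variables (R : realType) (n n' : nat).
Variables (a : 'I_n -> pt R) (b : 'I_n -> R) (P : set (pt R)) (hP : hrep a b P).
Variables (a' : 'I_n' -> pt R) (b' : 'I_n' -> R) (P' : set (pt R)) (hP' : hrep a' b' P').
Implicit Types (x y v : pt R) (f : 'M[R]_3 * pt R).

Lemma ap_convex f x y (s t : R) : s + t = 1 ->
  ap f (s *: x + t *: y) = s *: ap f x + t *: ap f y.
Proof.
move=> st; rewrite /ap /amap mulmxDl -!scalemxAl !scalerDr addrACA -scalerDl.
by rewrite st scale1r.
Qed.

(** A vector [u] killed by the transposed linear part would make [dot y u] constant on [P'], which
    has interior points. *)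
Lemma image_unitmx f : ap f @` P = P' -> f.1 \in unitmx.
Proof.
move=> fP; rewrite -unitmx_tr -row_free_unit -kermx_eq0; apply/rowV0P => u /sub_kermxP uf.
apply: contrapT => /eqP u0.
have [z hz] := hrep_int hP'; have [r [r0 hr]] := ball_slack hP' hz.
have q0 : 0 < r / 2 / nrm u by rewrite !divr_gt0 // nrm_gt0.
have cst y : P' y -> dot y u = dot f.2 u.
  rewrite -fP => -[x _ <-]; rewrite dotDl dotE -mulmxA -[f.1]trmxK -trmx_mul uf.
  by rewrite trmx0 mulmx0 mxE add0r.
have Pz : P' z by apply: hr; rewrite edistxx.
have Pq : P' (z + (r / 2 / nrm u) *: u).
  apply: hr; exact: edist_step.
have := cst _ Pq; rewrite dotDl dotZl (cst _ Pz) => /eqP.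
by rewrite -subr_eq0 addrC addKr mulf_eq0 dot_eq0 (negPf u0) gt_eqF.
Qed.

Lemma rigidity phi : (forall x, P x -> (#|tight a b x| <= 3)%N) ->
  comb_equiv P P' phi -> faces_affine_equiv P P' phi -> poly_affine_equiv P P' phi.
Proof.
move=> simple [phiv [phie [phif [_ [surj _]]]]] fae.
have hF i : exists f, ap f @` hfacet a b P i = phi (hfacet a b P i) /\
    forall G, is_vertex P G \/ is_edge P G -> G `<=` hfacet a b P i -> ap f @` G = phi G.
  have [A [c [_ [h1 h2]]]] := fae _ (hfacet_is_facet hP i).
  by exists (A, c).
have [F hFF] := choice hF.
have Fv i v : P v -> extreme a b v -> i \in tight a b v -> phi [set v] = [set ap (F i) v].
  move=> Pv ev /tightP ti; have [_ h] := hFF i.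
  rewrite -h ?image_set1 //; first by left; apply: (extreme_vertex hP).
  by move=> x ->; split.
have Fcompat i j v : P v -> extreme a b v -> i \in tight a b v -> j \in tight a b v ->
    ap (F i) v = ap (F j) v.
  move=> Pv ev ti tj; have : [set ap (F i) v] (ap (F i) v) by [].
  by rewrite -(Fv i) // (Fv j).
have [z hz] := hrep_int hP.
have Pz : P z by apply/(hrepE hP) => i; apply: ltW.
have [v0 [Pv0 ev0 _]] := extreme_above hP Pz.
have [e0 [d0 fr0]] := simple_frame ev0 (simple _ Pv0).
have [f f0] := frame_agree hP Fcompat Pv0 ev0 fr0.
have fw := agree_everywhere hP Fcompat simple Pv0 ev0 f0.
(* Some vertex lies on the same facet, and there [f] agrees with [F i] on the whole plane. *)
have ff i x : hfacet a b P i x -> ap f x = ap (F i) x.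
  move=> [Px xi]; have [v [Pv ev sv]] := extreme_above hP Px.
  by apply: (fw v Pv ev) => //; apply: (fintype.subsetP sv); apply/tightP.
have im i G : G `<=` hfacet a b P i -> ap f @` G = ap (F i) @` G.
  by move=> Gi; apply/seteqP; split=> _ [x Gx <-]; exists x; rewrite ?(ff i) //; apply: Gi.
have cell G : is_cell P G -> ap f @` G = phi G.
  move=> cG; have fG : is_face P G by case: cG => [[]|[[]|[]]].
  have [i Gi] := face_tight hP fG; rewrite (im i) //.
  case: cG => [vG|[eG|/(facetP hP) [j Gj]]].
  - by apply: (proj2 (hFF i)) => //; left.
  - by apply: (proj2 (hFF i)) => //; right.
  - by rewrite -(im i) // Gj (im j) //; case: (hFF j).
(* Convexity reduces both inclusions to vertices; a vertex of [P'] is reached because [phi] is onto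
   the cells. *)
have fP : ap f @` P = P'.
  apply/seteqP; split=> [_ [x Px <-]|y P'y].
    apply: (@convex_extreme_ind _ _ a b P hP (fun x => P' (ap f x))) Px _.
      by move=> p q s t s0 t0 st hp hq; rewrite ap_convex //; apply: (hrep_convex hP').
    move=> v Pv ev _; have vv := extreme_vertex hP Pv ev.
    have [[c [_ E]] _] := phiv _ vv.
    have : (ap f @` [set v]) (ap f v) by exists v.
    by rewrite (cell [set v]) ?E; [case | left].
  apply: (@convex_extreme_ind _ _ a' b' P' hP' (fun y => (ap f @` P) y)) P'y _.
    move=> _ _ s t s0 t0 st [p Pp <-] [q Pq <-]; exists (s *: p + t *: q).
      exact: (hrep_convex hP).
    exact: ap_convex.
  move=> v Pv ev _; have vv := extreme_vertex hP' Pv ev.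
  have [G [cG GE]] := surj [set v] (or_introl vv).
  have : [set v] v by [].
  rewrite -GE -cell // => -[x Gx <-]; exists x => //.
  by case: cG => [[[c [_ E]] _]|[[[c [_ E]] _]|[[c [_ E]] _]]]; move: Gx; rewrite E => -[].
exists f.1, f.2; split; first exact: image_unitmx fP.
by split.
Qed.

End Rigidity.

Lemma poly_affine_equiv_faces (R : realType) (P P' : set (pt R)) phi :
  poly_affine_equiv P P' phi -> faces_affine_equiv P P' phi.
Proof.
move=> [A [c [uA [_ h]]]] F fF; exists A, c; split=> //; split.
  by apply: h; right; right.
by move=> G [vG|eG] _; apply: h; [left | right; left].
Qed.

(** * Density *)

Section Perturbation.
Variables (R : realType) (n : nat) (a : 'I_n -> pt R) (b : 'I_n -> R).
Variables (P : set (pt R)) (hP : hrep a b P).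
Implicit Types (x y z : pt R) (t : R).

(** The linear functional [dot (x - z)] is bounded on the generators; its value at [x] then gives
    [nrm (x - z) ^+ 2 <= nrm (x - z) * D]. *)
Lemma conv_hull_bounded k (v : 'I_k -> pt R) z :
  exists D, 0 < D /\ forall x, conv_hull v x -> nrm (x - z) <= D.
Proof.
have [D [D0 hD]] := max_fin (fun i => nrm (v i - z)).
exists D; split=> // x hx; have [->|n0] := eqVneq (nrm (x - z)) 0; first exact: ltW.
have np : 0 < nrm (x - z) by rewrite lt_def n0 nrm_ge0.
have /(_ x hx) : forall x', conv_hull v x' -> dot (x - z) x' <= dot (x - z) z + nrm (x - z) * D.
  move=> x'; apply: conv_hull_le => i.
  have := dot_le (x - z) (v i - z); rewrite dotBr.
  have := ler_wpM2l (ltW np) (hD i); lra.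
by rewrite -lerBlDl -dotBr -sqr_nrm expr2 ler_pM2l //.
Qed.

Lemma hrep_bounded z : exists D, 0 < D /\ forall x, P x -> nrm (x - z) <= D.
Proof.
by have [k [v ->]] := hrep_conv_hull hP; apply: conv_hull_bounded.
Qed.

Definition hpoly (b' : 'I_n -> R) : set (pt R) := [set x | forall i, dot (a i) x <= b' i].

(** Planes move outward, so [P] stays inside the new body; a homothety of ratio [(1 + tau)^-1] about
    an interior point brings that body back into [P], moving points by at most [tau * D = e / 2]. *)
Lemma hrep_perturb e : 0 < e -> exists del, 0 < del /\
  forall s : 'I_n -> R, (forall i, 0 <= s i <= del) ->
  hrep a (fun i => b i + s i) (hpoly (fun i => b i + s i)) /\
  hclose e P (hpoly (fun i => b i + s i)).
Proof.
move=> e0; have [z hz] := hrep_int hP.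
have S0 i : 0 < b i - dot (a i) z by rewrite subr_gt0.
have [D [D0 hD]] := hrep_bounded z.
have [y hy] := choice (irr_mem hP).
pose tau := e / 2 / D.
have tau0 : 0 < tau by rewrite !divr_gt0.
(* [g (i, j)] limits the shift [s i] so that [y i], pushed away from [z] onto the new plane [i],
   keeps constraint [j] strict. *)
pose g (p : 'I_n * 'I_n) := if p.2 == p.1 then 1 else
  (b p.2 - dot (a p.2) (y p.1)) * (b p.1 - dot (a p.1) z) / (b p.2 - dot (a p.2) z).
have g0 p : 0 < g p.
  rewrite /g; case: eqP => // /eqP ji; rewrite divr_gt0 // mulr_gt0 // subr_gt0.
  by have [_ _ ->] := hy p.1.
have [d1 [d10 hd1]] := min_pos_fin g0.
have [d2 [d20 hd2]] := min_pos (fun i => mulr_gt0 tau0 (S0 i)).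
exists (Num.min (d1 / 2) d2); split; first by rewrite lt_min d20 divr_gt0.
move=> s hs.
have s0 i : 0 <= s i by case/andP: (hs i).
have sd1 i : s i < d1.
  by case/andP: (hs i) => _; rewrite le_min => /andP[h _]; lra.
have sd2 i : s i <= d2 by case/andP: (hs i) => _; rewrite le_min => /andP[_ h].
split; last first.
  split=> x.
    move=> Px; exists x; split; last by rewrite edistxx.
    by move=> i; have := hrep_le hP i Px; have := s0 i; lra.
  move=> Qx; pose p := z + (1 + tau)^-1 *: (x - z).
  have t1 : 0 < 1 + tau by rewrite addr_gt0.
  have Pp : P p.
    apply/(hrepE hP) => i; rewrite /p dotDr dotZr -lerBrDl mulrC ler_pdivrMr //.
    have := Qx i; have := hd2 i; have := sd2 i; rewrite dotBr; lra.
  exists p; split=> //.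
  have xp : p - x = - (tau *: (p - z)).
    by apply/rowP => i; rewrite !mxE; field; apply: lt0r_neq0.
  rewrite edistE xp nrmN nrmZ gtr0_norm //.
  have := ler_wpM2l (ltW tau0) (hD p Pp).
  by rewrite {2}/tau divfK ?gt_eqF //; lra.
split=> //.
- by exists z => i; apply: lt_le_trans (hz i) _; rewrite lerDl.
- move=> i; have [Py yi yj] := hy i.
  pose u := s i / (b i - dot (a i) z).
  have u0 : 0 <= u by rewrite divr_ge0 // ltW.
  exists (y i + u *: (y i - z)); rewrite dotDr dotZr dotBr yi; split.
    by rewrite /u divfK // gt_eqF.
  move=> j ji; rewrite dotDr dotZr dotBr.
  have h1 : u * (b j - dot (a j) z) < b j - dot (a j) (y i).
    rewrite /u -ltr_pdivlMr // ltr_pdivrMr // mulrAC.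
    apply: lt_le_trans (sd1 i) _.
    by have := hd1 (i, j); rewrite /g /= (negPf ji).
  have := ler_wpM2l u0 (hrep_le hP j Py); have := s0 j; lra.
- exact: hrep_rec hP.
Qed.
Lemma ex_nonroot (p : {poly R}) del : 0 < del -> p != 0 ->
  exists t, [/\ 0 < t, t < del & ~~ root p t].
Proof.
move=> d0 p0; apply: contrapT => h.
pose f k : R := del / k.+2%:R.
have : (size [seq f k | k <- iota 0 (size p)] < size p)%N.
  apply: max_poly_roots => //.
    apply/allP => _ /mapP [k _ ->]; apply/negPn/negP => hk; apply: h; exists (f k); split=> //.
      by rewrite divr_gt0 // ltr0n.
    by rewrite ltr_pdivrMr ?ltr0n // ltr_pMr // ltr1n.
  rewrite map_inj_uniq ?iota_uniq // => k l /(mulfI (lt0r_neq0 d0)) /invr_inj /eqP.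
  by rewrite eqr_nat => /eqP [].
by rewrite size_map size_iota ltnn.
Qed.

(* Four vectors of R^3 are dependent; the dependency turns concurrency of
   the shifted planes into a nontrivial polynomial equation for [t]. *)
Lemma concurrency_poly (S : {set 'I_n}) : (3 < #|S|)%N ->
  exists p : {poly R}, p != 0 /\ forall t x,
    (forall i, i \in S -> dot (a i) x = b i + t ^+ i.+1) -> root p t.
Proof.
move=> S4; pose e (k : 'I_#|S|) := enum_val k.
pose M : 'M[R]_(#|S|, 3) := \matrix_(k, j) a (e k) 0 j.
have : kermx M != 0.
  by rewrite -mxrank_eq0 mxrank_ker subn_eq0 -ltnNge (leq_ltn_trans (rank_leq_col _)).
case/rowV0Pn => u /sub_kermxP uM u0.
have [k uk] : exists k, u 0 k != 0.
  apply: contrapT => h; move/eqP: u0; apply; apply/rowP => k; rewrite mxE.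
  by apply/eqP/negPn/negP => hk; apply: h; exists k.
exists (\sum_l u 0 l *: ('X^((e l).+1) + (b (e l))%:P)); split.
  (* The exponents [i.+1] are distinct and positive, so this coefficient is [u 0 k], untouched by
     the constants [b]. *)
  apply/eqP => /polyP /(_ (e k).+1); rewrite coef0 coef_sum (bigD1 k) //= big1.
    by rewrite addr0 coefZ coefD coefXn eqxx coefC /= addr0 mulr1 => /eqP; rewrite (negPf uk).
  move=> l lk; rewrite coefZ coefD coefXn coefC /= addr0 eqSS.
  case: eqP => [h|_]; last by rewrite mulr0.
  by case/eqP: lk; apply: enum_val_inj; apply: val_inj.
move=> t x hx; apply/rootP; rewrite horner_sum.
transitivity (dot (u *m M) x); last by rewrite uM dot0l.
rewrite mulmx_sum_row dot_suml; apply: eq_bigr => l _.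
rewrite dotZl !hornerE; congr (_ * _).
have -> : row l M = a (e l) by apply/rowP => j; rewrite !mxE.
by rewrite hx ?enum_valP // addrC.
Qed.

Lemma simple_perturb e : 0 < e -> exists b' Q, [/\ hrep a b' Q, hclose e P Q &
  forall x, Q x -> (#|tight a b' x| <= 3)%N].
Proof.
move=> e0; have [del [d0 hdel]] := hrep_perturb e0.
(* Small sets get the polynomial 1; a nonroot of the product over all sets excludes every
   concurrency at once. *)
have hS (S : {set 'I_n}) : exists p : {poly R}, p != 0 /\ ((3 < #|S|)%N -> forall t x,
    (forall i, i \in S -> dot (a i) x = b i + t ^+ i.+1) -> root p t).
  case: (ltnP 3 #|S|) => [/concurrency_poly [p [p0 hp]]|_]; first by exists p.
  by exists 1; rewrite oner_neq0.
have [q hq] := choice hS.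
have [||t [t0 td rt]] := @ex_nonroot (\prod_S q S) (Num.min 1 del).
- by rewrite lt_min d0 ltr01.
- by apply/prodf_neq0 => S _; case: (hq S).
move: td; rewrite lt_min => /andP[t1 td].
exists (fun i => b i + t ^+ i.+1), (hpoly (fun i => b i + t ^+ i.+1)).
have [|hQ cl] := hdel (fun i => t ^+ i.+1).
  move=> i; rewrite exprn_ge0 ?ltW //= exprS (le_lt_trans _ td) //.
  by rewrite ger_pMr // exprn_ile1 // ltW.
split=> // x Qx; rewrite leqNgt; apply/negP => h4.
have [_ /(_ h4 t x) rq] := hq (tight a (fun i => b i + t ^+ i.+1) x).
move/negP: rt; apply; rewrite /root horner_prod; apply/prodf_eq0.
exists (tight a (fun i => b i + t ^+ i.+1) x) => //.
by apply: rq => i /tightP.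
Qed.

End Perturbation.

(** * Openness *)

Section Openness.
Variables (R : realType) (n : nat) (a : 'I_n -> pt R) (b : 'I_n -> R).
Variables (P : set (pt R)) (hP : hrep a b P).
Implicit Types (x y z p q : pt R) (t e : R) (Q : set (pt R)).

Lemma hclose_le e e' Q : e <= e' -> hclose e P Q -> hclose e' P Q.
Proof.
move=> ee [h1 h2]; split.
  by move=> x /h1 [y [Qy xy]]; exists y; split=> //; apply: lt_le_trans ee.
by move=> y /h2 [x [Px xy]]; exists x; split=> //; apply: lt_le_trans ee.
Qed.

Lemma dot_edist_lt (c : pt R) x y e : c != 0 -> edist x y < e ->
  dot c x < dot c y + nrm c * e.
Proof.
move=> c0 xy; have := dot_le c (x - y); rewrite dotBr -edistE.
have : nrm c * edist x y < nrm c * e by rewrite ltr_pM2l ?nrm_gt0.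
lra.
Qed.

Variables (z : pt R) (hz : forall i, dot (a i) z < b i).

(* [g x = b' k - dot (a' k) x], normalised by its value at the interior point
   [z], is close on [P] to the slack of facet [i] normalised in the same way:
   it is nearly nonnegative on [P] and nearly vanishes at the relative interior
   point [y] of facet [i], hence is nearly constant along that facet. *)
Lemma facet_close i y ep : 0 < ep -> P y -> dot (a i) y = b i ->
  (forall j, j != i -> dot (a j) y < b j) ->
  exists e, 0 < e /\ forall m (a' : 'I_m -> pt R) (b' : 'I_m -> R) Q,
    hrep a' b' Q -> hclose e P Q -> exists k,
    let g x := b' k - dot (a' k) x in
    [/\ 0 < g z, g y <= ep * g z,
     forall x, P x -> (b i - dot (a i) x) * g z <= (g x + ep * g z) * (b i - dot (a i) z) &
     forall x p, edist p x < e -> g p <= g x + ep * g z].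
Proof.
move=> ep0 Py yi yj.
have S0 j : 0 < b j - dot (a j) z by rewrite subr_gt0.
have ai0 : 0 < nrm (a i) by rewrite nrm_gt0 (facet_normal_neq0 hP).
have [D [D0 hD]] := hrep_bounded hP z.
have [r0 [r00 hr0]] := ball_slack hP hz.
pose Ga := 1 + nrm (a i) * D / (b i - dot (a i) z).
have Ga0 : 0 < Ga by rewrite ltr_pwDl // divr_ge0 ?(ltW (S0 i)) // mulr_ge0 // ltW.
pose gam x := (b i - dot (a i) x) / (b i - dot (a i) z).
have gamE x : gam x * (b i - dot (a i) z) = b i - dot (a i) x by rewrite /gam divfK ?gt_eqF.
have gam0 x : P x -> 0 <= gam x.
  by move=> Px; apply: divr_ge0; [rewrite subr_ge0 (hrep_le hP) | apply: ltW].
have gamG x : P x -> gam x <= Ga.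
  move=> Px; rewrite /gam ler_pdivrMr // /Ga mulrDl mul1r divfK ?gt_eqF //.
  have := dot_norm_le (a i) (x - z); rewrite ler_norml dotBr => /andP[h _].
  have := ler_wpM2l (ltW ai0) (hD x Px); lra.
(* Half of the slack of [y] at [j] absorbs the [gam] term of the slide below, and [kap <= 2^-1] the
   rest. The [gam x] correction cancels the change of slack [i], so the slide stays in plane [i]. *)
have [ka [ka0 hka]] : exists ka, 0 < ka /\ forall j,
    ka <= if j == i then 1 else (b j - dot (a j) y) / (2 * Ga * (b j - dot (a j) z)).
  apply: min_pos => j; case: eqP => // /eqP ji.
  by rewrite divr_gt0 ?subr_gt0 ?yj // !mulr_gt0 // subr_gt0.
pose kap := Num.min ka 2^-1.
have kap0 : 0 < kap by rewrite lt_min ka0 invr_gt0 ltr0n.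
have kapka : kap <= ka by rewrite ge_min lexx.
have kap2 : kap <= 2^-1 by rewrite ge_min lexx orbT.
have slide x : P x -> P (y + kap *: ((x - y) - gam x *: (z - y))).
  move=> Px; apply/(hrepE hP) => j; rewrite !dotl.
  have [->|ji] := eqVneq j i.
    have := gamE x; rewrite yi; nra.
  have := hka j; rewrite (negPf ji) ler_pdivlMr ?mulr_gt0 // => hk.
  have h1 := hrep_le hP j Px; have h2 := hrep_le hP j Py.
  have h3 : kap * gam x * (dot (a j) y - dot (a j) z) <= kap * gam x * (b j - dot (a j) z).
    apply: ler_wpM2l; first by rewrite mulr_ge0 ?(ltW kap0) ?gam0.
    by rewrite lerD2r.
  have h4 : kap * gam x * (b j - dot (a j) z) <= ka * Ga * (b j - dot (a j) z).
    by rewrite ler_wpM2r ?(ltW (S0 j)) // ler_pM ?gam0 ?gamG ?(ltW kap0).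
  have h5 : kap * (dot (a j) x - b j) <= 0.
    by apply: mulr_ge0_le0; [apply: ltW | rewrite subr_le0].
  have h6 : kap * (b j - dot (a j) y) <= 2^-1 * (b j - dot (a j) y).
    by rewrite ler_wpM2r // subr_ge0.
  lra.
(* Collects the error factors of the final estimate, whose total [2 * th * N] is then exactly
   [ep]. *)
pose N := 1 + Ga + kap^-1.
have N1 : 1 < N by rewrite /N -addrA ltrDl addr_gt0 // invr_gt0.
have N0 : 0 < N by lra.
pose th := ep / (2 * N).
have th0 : 0 < th by rewrite divr_gt0 // mulr_gt0.
have thN : 2 * th * N = ep by rewrite /th mulrAC mulrC divfK // gt_eqF // mulr_gt0.
have thep : th <= ep by nra.
have [e [e0 er ea e1]] : exists e, [/\ 0 < e, 4 * e <= r0, nrm (a i) * e <= th * (b i - dot (a i) z) &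
    4 * e <= th * r0].
  exists (Num.min (r0 / 4) (Num.min (th * (b i - dot (a i) z) / nrm (a i)) (th * r0 / 4))).
  split.
  - by rewrite !lt_min !divr_gt0 ?(mulr_gt0 th0).
  - by rewrite mulrC -ler_pdivlMr // ge_min lexx.
  - by rewrite mulrC -ler_pdivlMr // !ge_min lexx orbT.
  - by rewrite mulrC -ler_pdivlMr // !ge_min lexx !orbT.
exists e; split=> // m a' b' Q hQ [PQ QP].
(* This point overshoots facet [i] too far to lie in [Q]; an inequality of [Q] that it violates is
   the facet sought. *)
pose y' := y + th *: (y - z).
have nQ : ~ Q y'.
  move=> /QP [p [Pp py]].
  have := dot_edist_lt (facet_normal_neq0 hP i) (e := e); rewrite edistC in py.
  move/(_ _ _ py); have := hrep_le hP i Pp; rewrite /y' !dotl yi; lra.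
have [k hk] : exists k, b' k < dot (a' k) y'.
  apply: contrapT => h; apply: nQ; apply/(hrepE hQ) => k.
  by rewrite leNgt; apply/negP => hk; apply: h; exists k.
exists k => g.
have a'0 := facet_normal_neq0 hQ k.
have L0 : 0 < nrm (a' k) by rewrite nrm_gt0.
have gP x : P x -> - (nrm (a' k) * e) <= g x.
  move=> /PQ [q [Qq xq]]; have := dot_edist_lt a'0 xq; have := hrep_le hQ k Qq.
  rewrite /g; lra.
(* A ball about [z] lies in [P], where [g] is nearly nonnegative. The resulting lower bound on [g z]
   turns errors [nrm (a' k) * e] into multiples of [g z]. *)
have hG : nrm (a' k) * r0 / 4 <= g z.
  have q0 : 0 < r0 / 2 / nrm (a' k) by rewrite !divr_gt0.
  have /gP : P (z + (r0 / 2 / nrm (a' k)) *: a' k).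
    apply: hr0; exact: edist_step.
  rewrite /g dotDr dotZr -sqr_nrm expr2 mulrA divfK ?gt_eqF //.
  have := ler_wpM2l (ltW L0) er; lra.
have G0 : 0 < g z by apply: lt_le_trans hG; rewrite divr_gt0 // mulr_gt0.
have Le : nrm (a' k) * e <= th * g z.
  have := ler_wpM2l (ltW L0) e1; have := ler_wpM2l (ltW th0) hG; lra.
have gy : g y <= th * g z.
  have h : g y + th * (g y - g z) < 0 by move: hk; rewrite /y' /g !dotl; lra.
  have h2 := gP _ Py; have h3 : th * - (th * g z) <= th * g y.
    by rewrite ler_wpM2l ?(ltW th0) //; lra.
  case: (leP (g y) 0) => [gy0|gy0].
    by apply: le_trans gy0 _; rewrite mulr_ge0 ?ltW.
  have := mulr_gt0 th0 gy0; lra.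
have thG : th * g z <= ep * g z by rewrite ler_wpM2r // ltW.
split=> //; first exact: le_trans thG.
- move=> x Px.
  suff h : gam x * g z <= g x + ep * g z.
    by rewrite -gamE mulrAC ler_wpM2r // ltW.
  (* Near nonnegativity of [g] at the slid point bounds [dot (a' k) u] from above, hence [g x] from
     below. *)
  have := gP _ (slide x Px).
  set u := (x - y) - gam x *: (z - y).
  have gu : g x = gam x * g z + (1 - gam x) * g y - dot (a' k) u.
    rewrite /g /u !dotl; ring.
  have -> : g (y + kap *: u) = g y - kap * dot (a' k) u by rewrite /g !dotl; ring.
  move=> hu.
  have hu2 : dot (a' k) u <= 2 * th * g z * kap^-1.
    by rewrite ler_pdivlMr //; lra.
  have gy2 := gP _ Py.
  have gl := gam0 _ Px; have gG := gamG _ Px.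
  have h1 : - (2 * th * g z) * (1 + Ga) <= (1 - gam x) * g y.
    have A0 : 0 <= th * g z by rewrite mulr_ge0 ?ltW.
    have A1 : 0 <= th * g z - g y by lra.
    have A2 : 0 <= th * g z + g y by lra.
    have := mulr_ge0 gl A1; have := mulr_ge0 gl A2.
    have A3 : 0 <= Ga - gam x by lra.
    have := mulr_ge0 A3 A0; have := mulr_ge0 (ltW Ga0) A0; lra.
  have : ep * g z = 2 * th * g z * (1 + Ga) + 2 * th * g z * kap^-1.
    by rewrite -thN /N; ring.
  lra.
- move=> x p xp; have := dot_edist_lt a'0 (e := e); rewrite edistC in xp.
  move/(_ _ _ xp); have := le_trans Le thG; rewrite /g; lra.
Qed.

End Openness.

(** * Simple polyhedra form an open dense set *)

Section Simple.
Variables (R : realType) (n : nat).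
Implicit Types (P Q : set (pt R)).

Definition simple_M P := M_ n P /\ exists (a : 'I_n -> pt R) (b : 'I_n -> R),
  hrep a b P /\ forall x, P x -> (#|tight a b x| <= 3)%N.

(** If more than three facets of a nearby [Q] met at a point, the corresponding facets of [P] would
    all have small slack at a nearby point of [P], whereas their total slack is bounded below on
    [P]. *)
Lemma simple_open : hopen_in (M_ n) simple_M.
Proof.
move=> P [[[[l [v Pv]] _] _] [a [b [hP simple]]]].
have [z hz] := hrep_int hP.
have [y hy] := choice (irr_mem hP).
have [M [M0 hM]] := max_fin (fun i => b i - dot (a i) z).
have hS (S : {set 'I_n}) : exists d, 0 < d /\ ((3 < #|S|)%N ->
    forall p, P p -> d <= \sum_(i in S) (b i - dot (a i) p)).
  case: (ltnP 3 #|S|) => [S4|_]; last by exists 1.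
  (* Total slack is affine, so a positive bound at the generators holds on all of [P]. *)
  have pos j : 0 < \sum_(i in S) (b i - dot (a i) (v j)).
    have Pvj : P (v j) by rewrite Pv; apply: conv_hull_gen.
    rewrite lt_def sumr_ge0 ?andbT => [|i _]; last by rewrite subr_ge0 (hrep_le hP).
    apply/eqP => /eqP; rewrite psumr_eq0 => [/allP h|i _]; last by rewrite subr_ge0 (hrep_le hP).
    have := simple _ Pvj; rewrite leqNgt => /negP; apply.
    apply: leq_trans S4 _; apply: subset_leq_card; apply/fintype.subsetP => i iS.
    have := h i (mem_index_enum _); rewrite iS subr_eq0 => /eqP bi.
    by apply/tightP.
  have [d [d0 hd]] := min_pos pos.
  exists d; split=> // _ p; rewrite Pv sumrB -dot_suml lerBrDl -lerBrDr.
  apply: conv_hull_le => j; have := hd j; rewrite sumrB -dot_suml; lra.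
have [dS hdS] := choice hS.
have pos1 (pr : 'I_n * 'I_n) : 0 < if pr.1 == pr.2 then 1 else b pr.1 - dot (a pr.1) (y pr.2).
  by case: eqP => // /eqP ne; rewrite subr_gt0; have [_ _ ->] := hy pr.2.
have [h1 [h10 hh1]] := min_pos_fin pos1.
have pos2 S : 0 < dS S / n.+1%:R by rewrite divr_gt0 ?ltr0n //; case: (hdS S).
have [h2 [h20 hh2]] := min_pos_fin pos2.
(* [h1] keeps each [y j] away from the other facets, for the injectivity of [s]; [h2] keeps up to
   [n] slacks of size [h / 2] below [dS S] in total. *)
pose h := Num.min h1 h2.
have h0 : 0 < h by rewrite lt_min h10.
pose ep := h / (4 * M).
have ep0 : 0 < ep by rewrite divr_gt0 // mulr_gt0.
have epM : 2 * ep * M = h / 2 by rewrite /ep; field; rewrite gt_eqF.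
have hc i : exists e, 0 < e /\ forall (a' : 'I_n -> pt R) (b' : 'I_n -> R) Q,
    hrep a' b' Q -> hclose e P Q -> exists k,
    let g x := b' k - dot (a' k) x in
    [/\ 0 < g z, g (y i) <= ep * g z,
     forall x, P x -> (b i - dot (a i) x) * g z <= (g x + ep * g z) * (b i - dot (a i) z) &
     forall x p, edist p x < e -> g p <= g x + ep * g z].
  have [Py yi yj] := hy i; have [e [e0 he]] := facet_close hP hz ep0 Py yi yj.
  by exists e; split=> // a' b' Q; apply: he.
have [ei hei] := choice hc.
have [e [e0 he]] := min_pos (fun i => proj1 (hei i)).
exists e; split=> // Q MQ PQ; split=> //.
have [a' [b' hQ]] := M_hrep MQ; exists a', b'; split=> // x Qx.
have hk i := (proj2 (hei i)) a' b' Q hQ (hclose_le (he i) PQ).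
have [s hs] := choice hk.
have small i p : P p -> b' (s i) - dot (a' (s i)) p <= ep * (b' (s i) - dot (a' (s i)) z) ->
    b i - dot (a i) p <= h / 2.
  move=> Pp hp; have [G0 _ hC _] := hs i.
  have hC' := hC _ Pp.
  have S0 : 0 < b i - dot (a i) z by rewrite subr_gt0.
  have k1 : b i - dot (a i) p <= 2 * ep * (b i - dot (a i) z).
    rewrite -(ler_pM2r G0); apply: le_trans hC' _.
    have := ler_wpM2r (ltW S0) hp; lra.
  by apply: le_trans k1 _; rewrite -epM ler_wpM2l ?hM // mulr_ge0 // ltW.
have inj : injective s.
  move=> i j ij; apply/eqP/negPn/negP => ne.
  have [Pyj yj _] := hy j; have [_ gy _ _] := hs j.
  have := small i (y j) Pyj; rewrite ij => /(_ gy).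
  have := hh1 (i, j); rewrite /= (negPf ne).
  have : h <= h1 by rewrite ge_min lexx.
  lra.
(* The equality of facet counts enters here: an injection of ['I_n] into itself is bijective. *)
have [si sK siK] := injF_bij inj.
rewrite leqNgt; apply/negP => h4.
have [p [Pp px]] := (proj2 PQ) x Qx.
pose S := si @: tight a' b' x.
have cS : #|S| = #|tight a' b' x| by rewrite card_imset //; apply: can_inj siK.
have [_ /(_ _ p Pp)] := hdS S; rewrite cS => /(_ h4).
have sm i : i \in S -> b i - dot (a i) p <= h / 2.
  move=> /imsetP [k /tightP tk ->]; apply: small => //; rewrite siK.
  have [_ _ _ hD] := hs (si k); have := hD x p (lt_le_trans px (he _)).
  by rewrite siK tk subrr add0r.
apply/negP; rewrite -ltNge.
have le1 : \sum_(i in S) (b i - dot (a i) p) <= \sum_(i in S) h / 2 by apply: ler_sum.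
apply: le_lt_trans le1 _; rewrite sumr_const -[_ *+ #|S|]mulr_natr.
have := hh2 S; rewrite ler_pdivlMr ?ltr0n // => hd.
apply: lt_le_trans hd.
have hh : h / 2 < h2 by have : h <= h2; [rewrite ge_min lexx orbT | lra].
apply: (@le_lt_trans _ _ (h2 * #|S|%:R)).
  by rewrite ler_wpM2r // ltW.
by rewrite ltr_pM2l // ltr_nat ltnS (leq_trans (max_card _)) // card_ord.
Qed.

Lemma simple_dense : hdense_in (M_ n) simple_M.
Proof.
move=> P /M_hrep [a [b hP]] e e0; have [b' [Q [hQ PQ sQ]]] := simple_perturb hP e0.
by exists Q; split=> //; split; [apply: hrep_M hQ | exists a, b'].
Qed.

End Simple.

Theorem theorem6 (R : realType) (n : nat) : (4 <= n)%N ->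
  exists Omega : set (set (pt R)),
    Omega `<=` M_ n /\ hopen_in (M_ n) Omega /\ hdense_in (M_ n) Omega /\
    forall P P', Omega P -> Omega P' ->
      ((exists phi, comb_equiv P P' phi /\ faces_affine_equiv P P' phi) <->
       (exists phi, comb_equiv P P' phi /\ poly_affine_equiv P P' phi)).
Proof.
move=> _; exists (@simple_M R n); split; first by move=> P [].
split; first exact: simple_open.
split; first exact: simple_dense.
move=> P P' [_ [a [b [hP simple]]]] [_ [a' [b' [hP' _]]]].
split=> -[phi [ce h]]; exists phi; split=> //; first exact: (rigidity hP hP').
exact: poly_affine_equiv_faces.
Qed.
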